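(* Let $\Delta$ be a combinatorial manifold and $\sigma_0$ a facet of $\Delta$. The reduced group of projectivities $\Pi_0(\Delta,\sigma_0)$ is generated by the set of all projectivities $\langle g*l*g^-\rangle$, where $g$ is a facet path from $\sigma_0$ to some facet $\sigma$ which contains an odd codimension-$2$-face $\kappa$, and $l$ is a facet loop in $\mathrm{st}\,\kappa$ based at $\sigma$ such that $\langle l\rangle$ generates $\Pi(\mathrm{st}\,\kappa,\sigma)$. In particular, $\Pi_0(\Delta,\sigma_0)$ is generated by transpositions.
   Context: A simplicial complex on a vertex set $V$ is a non-empty collection $\Delta$ of finite subsets (simplices, faces) of $V$ closed under taking subsets; $\dim\sigma=\#\sigma-1$. A facet is an inclusion-maximal simplex; a ridge is a maximal proper face of a facet. The star $\mathrm{st}\,\sigma$ of a face $\sigma$ is the subcomplex generated by the facets containing $\sigma$; the link $\mathrm{lk}\,\sigma$ is the subcomplex of $\mathrm{st}\,\sigma$ of faces disjoint from $\sigma$. A finite $d$-dimensional simplicial complex $\Delta$ ($d\ge1$) is a combinatorial manifold if the link of each (non-empty) $k$-face is a simplicial sphere of dimension $d-k-1$. In particular manifolds are compact and without boundary. A codimension-$2$-face is a (non-empty) face $\kappa$ of dimension $d-2$; its link is the boundary of an $n$-gon for some $n\ge3$, and $\kappa$ is called even or odd according to the parity of $n$. $\|\Delta\|$ denotes the geometric realization. Two distinct facets are adjacent iff they share a common ridge, i.e. iff $\sigma\cap\tau$ has exactly one element less than each of $\sigma,\tau$. For adjacent facets $\sigma,\tau$ let $v(\sigma,\tau)$ be the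 unique vertex in $\sigma\setminus\tau$. The perspectivity $\langle\sigma,\tau\rangle:\sigma\to\tau$ is the bijection sending $v(\sigma,\tau)$ to $v(\tau,\sigma)$ and fixing every other vertex of $\sigma$. A facet path is a sequence $g=(\sigma_0,\ldots,\sigma_n)$ of facets with consecutive ones adjacent; the projectivity along $g$ is $\langle g\rangle=\langle\sigma_0,\sigma_1\rangle\cdots\langle\sigma_{n-1},\sigma_n\rangle$ (leftmost map applied first), a bijection from $\sigma_0$ to $\sigma_n$. $g*h$ denotes concatenation of facet paths and $g^-$ the inverse (reversed) path. A facet loop based at $\sigma_0$ is a facet path from $\sigma_0$ to $\sigma_0$. The group of projectivities $\Pi(\Delta,\sigma_0)\le\mathrm{Sym}(\sigma_0)$ is the group of all projectivities along facet loops based at $\sigma_0$ (and likewise for the complex $\mathrm{st}\,\kappa$ and its facet $\sigma$; for odd $\kappa$ the group $\Pi(\mathrm{st}\,\kappa,\sigma)$ has order $2$). A facet path is identified with the path in $\|\Delta\|$ which runs, in the first barycentric subdivision, from the barycenter of $\sigma_i$ via the barycenter of the ridge $\sigma_i\cap\sigma_{i+1}$ to the barycenter of $\sigma_{i+1}$, for each $i$. The reduced group of projectivities $\Pi_0(\Delta,\sigma_0)$ is the subgroup of $\Pi(\Delta,\sigma_0)$ generated by the projectivities along null-homotopic facet loops based at $\sigma_0$. *)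

(* Defs.v *)
From mathcomp Require Import all_boot all_order all_algebra all_fingroup.
From mathcomp Require Import all_classical all_reals all_analysis.

Set Implicit Arguments.
Unset Strict Implicit.
Unset Printing Implicit Defensive.

Import GroupScope.
Import Order.TTheory GRing.Theory Num.Theory.
Import numFieldNormedType.Exports.

Section Combinatorics.
Variable V : finType.
Implicit Types (C : {set {set V}}) (s t k : {set V}) (g h : seq {set V}).

Definition simplicial_complex C : Prop :=
  C != finset.set0 /\
  forall s t, s \in C -> t \subset s -> t \in C.

(* [complex_size C] is dim C + 1, as #|s| is dim s + 1; these avoid the
   dimension -1 of the empty simplex and of the complex {set0}. *)
Definition complex_size C : nat := \max_(s in C) #|s|.

Definition facet C s : bool := maxset (fun t => t \in C) s.

Definition star C s : {set {set V}} :=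
  [set t : {set V} | [exists f, [&& facet C f, s \subset f & t \subset f]]]%SET.

Definition link C s : {set {set V}} :=
  [set t in star C s | [disjoint t & s]]%SET.

Definition ngon_boundary (n : nat) C : Prop :=
  2 < n /\ exists2 v : 'I_n -> V, injective v &
    C = [set t : {set V} | (t == finset.set0) ||
          [exists i, (t == [set v i]) || (t == [set v i; v (ordS i)])]]%SET.

Definition codim2_face C k : Prop :=
  [/\ k \in C, k != finset.set0 & #|k|.+2 = complex_size C].

Definition odd_codim2_face C k : Prop :=
  codim2_face C k /\ exists2 n : nat, odd n & ngon_boundary n (link C k).

Definition adjacent_facets s t : bool :=
  (#|s :&: t|.+1 == #|s|) && (#|s :&: t|.+1 == #|t|).

(* The perspectivity s -> t is represented by the permutation of the whole
   vertex set exchanging v(s,t) and v(t,s); only its restriction to s is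
   meaningful, see [perspectivity_vertex], [perspectivity_fix] and
   [perspectivity_imset]. *)
Definition perspectivity s t : {perm V} :=
  if [pick v in s :\: t] is Some v then
    if [pick w in t :\: s] is Some w then tperm v w else 1
  else 1.

(* A facet path (s, g_0, ..., g_(n-1)) is given by its first facet s and the
   sequence g of the remaining ones, as in mathcomp.boot.path; concatenation
   of facet paths is then [++] on the tails. *)
Definition facet_path C s g : bool :=
  all (facet C) (s :: g) && path adjacent_facets s g.

Definition facet_loop C s g : bool := facet_path C s g && (last s g == s).

(* Tail of the reversed path, whose first facet is [last s g]. *)
Definition inverse_path s g : seq {set V} := rev (belast s g).

(* In {perm V}, p * q applies p first. As for perspectivities, only the
   restriction to s is meaningful. *)
Definition path_projectivity s g : {perm V} :=
  \prod_(p <- pairmap perspectivity s g) p.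

(* For a facet loop based at s, the element of Sym(s) it induces. Sym(s) is
   [Sym s], the group of the permutations of V with support in s. *)
Definition projectivity s g : {perm V} := restr_perm s (path_projectivity s g).

Definition Pi C s : {set {perm V}} :=
  [set p : {perm V} | `[< exists2 l, facet_loop C s l & p = projectivity s l >]]%SET.

Definition odd_generators C s0 : {set {perm V}} :=
  [set p : {perm V} | `[< exists (g : seq {set V}) (k : {set V}) (l : seq {set V}),
    let s := last s0 g in
    [/\ facet_path C s0 g,
        odd_codim2_face C k /\ k \subset s,
        facet_loop (star C k) s l,
        <[projectivity s l]> = Pi (star C k) s
      & p = projectivity s0 (g ++ l ++ inverse_path s0 g)] >]]%SET.

Definition transposition s (p : {perm V}) : Prop :=
  exists x y, [/\ x \in s, y \in s, x != y & p = tperm x y].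

Lemma perspectivityE s t : adjacent_facets s t -> exists v w,
  [/\ s :\: t = [set v]%SET, t :\: s = [set w]%SET
    & perspectivity s t = tperm v w].
Proof.
case/andP=> /eqP cs /eqP ct.
have /cards1P[v dv] : #|s :\: t| == 1%N.
  by rewrite cardsD -cs subSnn.
have /cards1P[w dw] : #|t :\: s| == 1%N.
  by rewrite cardsD finset.setIC -ct subSnn.
exists v, w; split=> //; rewrite /perspectivity dv dw.
case: pickP => [v'|/(_ v)]; last by rewrite inE eqxx.
rewrite inE => /eqP ->.
case: pickP => [w'|/(_ w)]; last by rewrite inE eqxx.
by rewrite inE => /eqP ->.
Qed.

Lemma perspectivity_vertex s t v w : adjacent_facets s t ->
  v \in s :\: t -> w \in t :\: s -> perspectivity s t v = w.
Proof.
case/perspectivityE=> v' [w' [-> -> ->]]; rewrite !inE => /eqP -> /eqP ->.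
exact: tpermL.
Qed.

Lemma perspectivity_fix s t v : adjacent_facets s t ->
  v \in s :&: t -> perspectivity s t v = v.
Proof.
case/perspectivityE=> v' [w' [dv dw ->]] /finset.setIP[vs vt].
have nv : v' != v.
  apply/eqP=> e; have : v' \in s :\: t by rewrite dv inE.
  by rewrite e inE vt.
have nw : w' != v.
  apply/eqP=> e; have : w' \in t :\: s by rewrite dw inE.
  by rewrite e inE vs.
by rewrite tpermD.
Qed.

Lemma perspectivity_imset s t : adjacent_facets s t ->
  perspectivity s t @: s = t.
Proof.
move=> st; apply/eqP; rewrite eqEcard card_imset; last exact: perm_inj.
case/andP: (st) => /eqP <- /eqP <-; rewrite leqnn andbT.
apply/fintype.subsetP=> _ /imsetP[x xs ->].
have [xt|xt] := boolP (x \in t).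
  by rewrite (perspectivity_fix st) // inE xs.
have [v [w [dv dw _]]] := perspectivityE st.
have wt : w \in t :\: s by rewrite dw inE.
rewrite (perspectivity_vertex (w := w) st) //; last by rewrite inE xt.
by case/finset.setDP: wt.
Qed.

Lemma path_projectivity_imset s g : path adjacent_facets s g ->
  path_projectivity s g @: s = last s g.
Proof.
rewrite /path_projectivity; elim: g s => [|t g IH] s /=.
  rewrite big_nil => _; under eq_imset => x do rewrite perm1.
  exact: imset_id.
case/andP=> st tg; rewrite big_cons -(IH t tg).
rewrite -(perspectivity_imset st) -imset_comp.
by rewrite (perspectivity_imset st); apply: eq_imset => x; rewrite permM.
Qed.

Lemma projectivityE C s l v : facet_loop C s l -> v \in s ->
  projectivity s l v = path_projectivity s l v.
Proof.
case/andP=> /andP[_ sl] /eqP ls vs; apply: restr_permE => //.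
have ps : path_projectivity s l @: s = s by rewrite path_projectivity_imset.
move: (path_projectivity s l) ps => p ps.
apply/astabsP=> x; rewrite -{1}ps /= apermE.
by rewrite mem_imset //; apply: perm_inj.
Qed.

End Combinatorics.

Section Topology.
Local Open Scope classical_set_scope.
Local Open Scope ring_scope.

Definition homeomorphic (X Y : topologicalType) (A : set X) (B : set Y) : Prop :=
  exists (f : X -> Y) (g : Y -> X),
    [/\ {within A, continuous f} /\ {within B, continuous g},
        set_fun A B f, set_fun B A g,
        {in A, cancel f g} & {in B, cancel g f}].

(* S^(m-1) in R^m; it is empty for m = 0. *)
Definition unit_sphere (R : realType) (m : nat) : set 'rV[R]_m :=
  [set x | \sum_(i < m) x 0 i ^+ 2 = 1].

(* A loop in A, parametrised by [0,1], which is homotopic in A, relative to its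
   end points, to a constant loop. *)
Definition null_homotopic (R : realType) (X : topologicalType) (A : set X)
    (c : R -> X) : Prop :=
  exists H : R * R -> X,
    [/\ {within (`[0, 1] `*` `[0, 1])%classic, continuous H},
        set_fun (`[0, 1] `*` `[0, 1])%classic A H,
        forall t : R, t \in `[0, 1] -> H (t, 0) = c t,
        forall t : R, t \in `[0, 1] -> H (t, 1) = c 0
      & forall u : R, u \in `[0, 1] -> H (0, u) = c 0 /\ H (1, u) = c 0].

(* The polygonal path with vertices x, s_0, ..., s_(n-1), at constant speed on
   each of the n subintervals of [0,1] of length 1/n: the i-th clamp rises from
   0 to 1 on [i/n, (i+1)/n]. *)
Definition polygonal_path (R : realType) (m : nat) (x : 'rV[R]_m)
    (s : seq 'rV[R]_m) (t : R) : 'rV[R]_m :=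
  x + \sum_(i < size s)
        Num.max 0 (Num.min 1 ((size s)%:R * t - i%:R))
          *: (nth 0 s i - nth 0 (x :: s) i).

End Topology.

Section Realization.
Variables (R : realType) (V : finType).
Implicit Types (C : {set {set V}}) (s : {set V}) (g : seq {set V}).
Local Open Scope ring_scope.

(* The geometric realization lives in R^V, with coordinates numbered by
   [enum_rank]: barycentric coordinates with support a simplex of C. *)
Definition realization C : set 'rV[R]_#|V| :=
  [set x | [/\ forall i, 0 <= x 0 i,
               \sum_i x 0 i = 1
             & [set v | x 0 (enum_rank v) != 0]%SET \in C]]%classic.

Definition barycenter s : 'rV[R]_#|V| :=
  \row_i (if enum_val i \in s then #|s|%:R^-1 else 0).

Definition realization_path s g : R -> 'rV[R]_#|V| :=
  polygonal_path (barycenter s)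
    (flatten (pairmap (fun t u => [:: barycenter (t :&: u); barycenter u]) s g)).

(* A simplicial sphere of dimension m - 1; {set0} is one of dimension -1. *)
Definition simplicial_sphere (m : nat) C : Prop :=
  [/\ simplicial_complex C, complex_size C = m
    & homeomorphic (realization C) (unit_sphere (R := R) (m := m))].

Definition combinatorial_manifold (d : nat) C : Prop :=
  [/\ (1 <= d)%N, simplicial_complex C, complex_size C = d.+1
    & forall s, s \in C -> s != finset.set0 ->
        simplicial_sphere (d.+1 - #|s|) (link C s)].

Definition Pi0 C s0 : {set {perm V}} :=
  <<[set p : {perm V} | `[< exists l,
      [/\ facet_loop C s0 l,
          null_homotopic (realization C) (realization_path s0 l)
        & p = projectivity s0 l] >]]%SET>>%g.

End Realization.

(* Main.v *)
Require Import Defs.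
From mathcomp Require Import all_boot all_order all_algebra all_fingroup.
From mathcomp Require Import cyclic ring lra zify.
From mathcomp Require Import all_classical all_reals all_analysis.

(** A null-homotopy of a facet loop is observed only through the facets that it
    meets. Subdivide the square so finely that every small square is mapped
    into the open star of one vertex, and choose at every grid point a facet
    containing the support of its image. The facets chosen at the ends of an
    edge of the grid lie in the stars of the vertices of the adjacent squares,
    so they are joined by a facet path there, and around every small square
    one gets a facet loop in the star of a vertex. Hence the given loop is, up
    to backtracking, a product of conjugates of facet loops in vertex stars
    ([grid_trivial], [contraction_good]). The joining paths exist because stars
    of non-empty faces are strongly connected ([face_connected]): a link of
    codimension at least 2 is a connected sphere, and a path in it is
    subdivided in the same way.

    It remains to see that facet loops in the star of a non-empty face [k] give
    elements of the group generated by the odd loops ([face_trivial]), by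
    downward induction on the dimension of [k]; [k] is fixed by their
    projectivities. Up to codimension 1 there is at most one other vertex, and
    the projectivity is trivial. In codimension 2 the link is a 2-regular
    connected graph, a polygon, and only two vertices of a facet can move. If
    the polygon is even, perspectivities preserve a 2-colouring of its
    vertices and these two are fixed; if it is odd and they are exchanged, then
    the loop is itself one of the generators ([codim2_trivial]). In higher
    codimension the link is a sphere of dimension at least 2, hence simply
    connected ([sphere_contract]), and the subdivision argument applies within
    the link: its vertex stars come from stars of larger faces.

    Conversely the generators come from null-homotopic loops, because the star
    of [k] is a cone over the barycenter of [k] ([lasso_null_homotopic]). They
    are conjugate to elements moving at most two vertices, so the nontrivial
    ones are transpositions ([odd_generator_transposition]).

    Projectivities are handled as permutations of the whole vertex set: there
    the projectivity of a reversed path is the inverse one, and restriction to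
    a facet is a morphism on its stabiliser. *)

Set Implicit Arguments.
Unset Strict Implicit.
Unset Printing Implicit Defensive.

(** * Facet paths and their projectivities *)

Section FacetPaths.
Local Open Scope group_scope.
Variables (V : finType) (C : {set {set V}}).
Implicit Types (s t u k : {set V}) (g h l : seq {set V}) (p q r a : {perm V}).

Lemma star_facetE k s : facet (star C k) s = facet C s && (k \subset s).
Proof.
apply/maxsetP/andP => [[]|[fs ks]].
  rewrite inE => /existsP[f /and3P[fC kf sf]] max.
  have fst : f \in star C k.
    by rewrite inE; apply/existsP; exists f; rewrite fC kf subxx.
  by rewrite -(max f fst sf).
split=> [|t].
  by rewrite inE; apply/existsP; exists s; rewrite fs ks subxx.
rewrite inE => /existsP[f /and3P[fC kf tf]] st.
have fs' : f = s.
  case/maxsetP: fs => _; apply; first by case/maxsetP: fC.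
  exact: fintype.subset_trans tf.
by apply/eqP; rewrite finset.eqEsubset st andbT -fs' tf.
Qed.

Lemma facet_path_starP k s g :
  facet_path (star C k) s g <->
  [/\ forall t, t \in s :: g -> facet C t /\ k \subset t
    & path (@adjacent_facets V) s g].
Proof.
split=> [/andP[/allP sg ->]|[sg pg]].
  by split=> // t /sg; rewrite star_facetE => /andP.
by apply/andP; split=> //; apply/allP => t /sg [ft kt]; rewrite star_facetE ft.
Qed.

Lemma facet_path_star0 s g : facet_path (star C finset.set0) s g = facet_path C s g.
Proof.
by rewrite /facet_path; congr andb; apply: eq_all => t;
  rewrite star_facetE finset.sub0set andbT.
Qed.

Lemma adjacent_facets_sym s t : adjacent_facets s t = adjacent_facets t s.
Proof. by rewrite /adjacent_facets andbC finset.setIC. Qed.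

Lemma perspectivity_sym s t : adjacent_facets s t ->
  perspectivity t s = perspectivity s t.
Proof.
move=> st; have [v [w [dv dw ->]]] := perspectivityE st.
have ts : adjacent_facets t s by rewrite adjacent_facets_sym.
have [v' [w' [dv' dw' ->]]] := perspectivityE ts.
move: dv'; rewrite dw => /set1_inj ->.
by move: dw'; rewrite dv => /set1_inj ->; rewrite tpermC.
Qed.

Lemma perspectivity2 s t : adjacent_facets s t ->
  perspectivity s t * perspectivity s t = 1.
Proof. by case/perspectivityE => v [w [_ _ ->]]; rewrite tperm2. Qed.

Lemma path_projectivity_nil s : path_projectivity s [::] = 1.
Proof. by rewrite /path_projectivity /= big_nil. Qed.

Lemma path_projectivity_cons s t g :
  path_projectivity s (t :: g) = perspectivity s t * path_projectivity t g.
Proof. by rewrite /path_projectivity /= big_cons. Qed.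

Lemma path_projectivity_cat s g h :
  path_projectivity s (g ++ h) = path_projectivity s g * path_projectivity (last s g) h.
Proof.
elim: g s => [|t g IH] s /=; first by rewrite path_projectivity_nil mul1g.
by rewrite !path_projectivity_cons IH mulgA.
Qed.

Lemma last_inverse_path s g : last (last s g) (inverse_path s g) = s.
Proof. by case: g => [|t g] //=; rewrite /inverse_path /= rev_cons last_rcons. Qed.

Lemma path_inverse_path s g : path (@adjacent_facets V) s g ->
  path (@adjacent_facets V) (last s g) (inverse_path s g).
Proof.
rewrite /inverse_path rev_path => sg.
by rewrite (@eq_path _ _ (@adjacent_facets V)) // => x y /=; rewrite adjacent_facets_sym.
Qed.

Lemma path_projectivity_inverse s g : path (@adjacent_facets V) s g ->
  path_projectivity (last s g) (inverse_path s g) = (path_projectivity s g)^-1.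
Proof.
elim: g s => [|t g IH] s /=; first by rewrite !path_projectivity_nil invg1.
case/andP => st tg; rewrite path_projectivity_cons invMg /inverse_path /=.
rewrite rev_cons -cats1 path_projectivity_cat IH // path_projectivity_cons.
rewrite path_projectivity_nil mulg1 last_inverse_path perspectivity_sym //.
by congr (_ * _); apply/esym/eqP; rewrite eq_invg_mul perspectivity2.
Qed.

(** Each of the vertices exchanged by a perspectivity lies in one facet only. *)
Lemma perspectivity_fixI s t x : x \in s -> x \in t -> perspectivity s t x = x.
Proof.
move=> xs xt; rewrite /perspectivity.
case: pickP => [v|]; rewrite ?perm1 // inE => /andP[vt vs].
case: pickP => [w|]; rewrite ?perm1 // inE => /andP[ws wt].
by rewrite tpermD //; [apply: contraNneq vt | apply: contraNneq ws] => ->.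
Qed.

(** Facet paths within the star of [k] matter only through their projectivities,
    the morphisms of a groupoid on facets. For empty [k] the star is the whole
    complex. *)
Definition walk k s t p : Prop := exists g,
  [/\ facet_path (star C k) s g, last s g = t & path_projectivity s g = p].

Lemma walk_facets k s t p : walk k s t p ->
  [/\ facet C s, k \subset s, facet C t & k \subset t].
Proof.
case=> g [/facet_path_starP[sg _] <- _].
have [] := sg s (mem_head _ _); have [] := sg _ (mem_last s g).
by split.
Qed.

Lemma walk1 k s : facet C s -> k \subset s -> walk k s s 1.
Proof.
move=> fs ks; exists [::]; split=> //; last exact: path_projectivity_nil.
by apply/facet_path_starP; split=> // t; rewrite inE => /eqP ->.
Qed.

Lemma walk_step k s t : facet C s -> facet C t -> k \subset s -> k \subset t ->
  adjacent_facets s t -> walk k s t (perspectivity s t).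
Proof.
move=> fs ft ks kt st; exists [:: t]; split=> //.
  apply/facet_path_starP; split=> [u|]; last by rewrite /= st.
  by rewrite !inE => /orP[] /eqP ->.
by rewrite path_projectivity_cons path_projectivity_nil mulg1.
Qed.

Lemma walkM k s t u p q : walk k s t p -> walk k t u q -> walk k s u (p * q).
Proof.
case=> g [/facet_path_starP[sg pg] lg <-] [h [/facet_path_starP[sh ph] lh <-]].
exists (g ++ h); split; last by rewrite path_projectivity_cat lg.
  apply/facet_path_starP; rewrite cat_path pg lg ph; split=> // v.
  rewrite inE mem_cat orbA -in_cons => /orP[/sg //|vh].
  by apply: sh; rewrite inE vh orbT.
by rewrite last_cat lg.
Qed.

Lemma walkV k s t p : walk k s t p -> walk k t s p^-1.
Proof.
case=> g [/facet_path_starP[sg pg] lg <-]; exists (inverse_path s g).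
rewrite -lg path_projectivity_inverse // last_inverse_path; split=> //.
apply/facet_path_starP; split; last exact: path_inverse_path.
move=> v; rewrite /inverse_path -rev_rcons mem_rev -lastI; exact: sg.
Qed.

Lemma walkS k k' s t p : k \subset k' -> walk k' s t p -> walk k s t p.
Proof.
move=> kk [g [/facet_path_starP[sg pg] lg <-]]; exists g; split=> //.
apply/facet_path_starP; split=> // v /sg[fv kv]; split=> //.
exact: fintype.subset_trans kv.
Qed.

Lemma walk_imset k s t p : walk k s t p -> p @: s = t.
Proof. by case=> g [/facet_path_starP[_ pg] <- <-]; apply: path_projectivity_imset. Qed.

Lemma walk_fix k s t p x : walk k s t p -> x \in k -> p x = x.
Proof.
case=> g [/facet_path_starP[sg _] _ <-] xk.
elim: g s sg => [|t' g IH] s sg; first by rewrite path_projectivity_nil perm1.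
rewrite path_projectivity_cons permM perspectivity_fixI.
- by apply: IH => v vg; apply: sg; rewrite inE vg orbT.
- by have [_ /fintype.subsetP] := sg s (mem_head _ _); apply.
- by have [_ /fintype.subsetP] := sg t' (mem_behead (s := s :: t' :: g) (mem_head _ _));
    apply.
Qed.

Lemma imset_astabs s p : p @: s = s -> p \in 'N(s | 'P).
Proof.
move=> ps; apply/astabsP=> x; rewrite -{1}ps /= apermE.
by rewrite mem_imset //; apply: perm_inj.
Qed.

Section Modulo.
Variables (s0 : {set V}) (N : {group {perm V}}).

(** The loop [r] at [t] becomes an element of [N] after transport to the base
    facet, along whatever path. Quantifying over all paths makes the
    property invariant under conjugation by paths ([goodJ]). *)
Definition good t r : Prop := forall a, walk finset.set0 s0 t a ->
  restr_perm s0 (a * r * a^-1) \in N.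

(** Homotopy of facet paths, seen through their projectivities: the quotient
    of the groupoid of projectivities by the normal subgroupoid of loops that
    become elements of [N] after transport to the base facet. *)
Definition eqv s t p q : Prop :=
  [/\ walk finset.set0 s t p, walk finset.set0 s t q & good s (p * q^-1)].

Lemma walk_astabs t r a : walk finset.set0 s0 t a -> walk finset.set0 t t r ->
  a * r * a^-1 \in 'N(s0 | 'P).
Proof. by move=> wa wr; apply: imset_astabs; apply: walk_imset (walkM (walkM wa wr)
  (walkV wa)). Qed.

Lemma goodM t r r' : walk finset.set0 t t r -> walk finset.set0 t t r' ->
  good t r -> good t r' -> good t (r * r').
Proof.
move=> wr wr' gr gr' a wa.
have -> : a * (r * r') * a^-1 = (a * r * a^-1) * (a * r' * a^-1).
  by rewrite !mulgA mulgKV.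
by rewrite morphM ?(walk_astabs wa) // groupM ?gr ?gr'.
Qed.

Lemma goodJ s t q r : walk finset.set0 s t q -> good t r -> good s (q * r * q^-1).
Proof.
move=> wq gr a wa; have := gr _ (walkM wa wq).
by rewrite invMg !mulgA.
Qed.

(** Outside of [t] the permutation [r] is irrelevant, since restriction to the
    base facet forgets its values there. *)
Lemma good1 t r : walk finset.set0 t t r -> {in t, forall x, r x = x} -> good t r.
Proof.
move=> wr r1 a wa; rewrite (_ : restr_perm _ _ = 1) ?group1 //.
apply/permP => x; rewrite perm1; have [xs|xs] := boolP (x \in s0); last first.
  by rewrite (out_perm (restr_perm_on _ _)).
rewrite restr_permE ?(walk_astabs wa) // !permM r1 ?permK //.
by rewrite -(walk_imset wa) imset_f.
Qed.

Lemma eqv_refl s t p : walk finset.set0 s t p -> eqv s t p p.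
Proof.
move=> wp; split=> //; rewrite mulgV.
case: (walk_facets wp) => fs _ _ _.
by apply: good1 => [|x _]; rewrite ?perm1 //; apply: walk1; rewrite ?finset.sub0set.
Qed.

Lemma eqv_trans s t q p r : eqv s t p q -> eqv s t q r -> eqv s t p r.
Proof.
case=> wp wq gpq [_ wr gqr]; split=> //.
have -> : p * r^-1 = (p * q^-1) * (q * r^-1) by rewrite mulgA mulgKV.
apply: goodM => //; first exact: walkM wp (walkV wq).
exact: walkM wq (walkV wr).
Qed.

Lemma eqvM s t u p q p' q' : eqv s t p q -> eqv t u p' q' ->
  eqv s u (p * p') (q * q').
Proof.
case=> wp wq gpq [wp' wq' gpq']; split; [exact: walkM wp'|exact: walkM wq'|].
have -> : p * p' * (q * q')^-1 = (p * (p' * q'^-1) * p^-1) * (p * q^-1).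
  by rewrite invMg !mulgA mulgKV.
apply: goodM; last by [].
- exact: walkM (walkM wp (walkM wp' (walkV wq'))) (walkV wp).
- exact: walkM wp (walkV wq).
- exact: goodJ wp gpq'.
Qed.

Lemma eqv_good t p : eqv t t p 1 -> good t p.
Proof. by case=> _ _; rewrite invg1 mulg1. Qed.

Definition trivial_star k : Prop := forall t p, walk k t t p -> good t p.

Definition connected_star k : Prop := forall s t,
  facet C s -> facet C t -> k \subset s -> k \subset t -> exists p, walk k s t p.

Lemma trivial_star_eqv k s t p q : trivial_star k ->
  walk k s t p -> walk k s t q -> eqv s t p q.
Proof.
move=> tk wp wq; split; try exact: walkS (finset.sub0set k) _.
exact/tk/(walkM wp)/walkV.
Qed.

(** One strip of cells: two rows with the same horizontal ends are equivalent
    up to the vertical edges at the ends, the inner ones cancelling. *)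
Lemma grid_row (K : nat) (F F' : nat -> {set V}) (cell : nat -> {set V})
    (h h' v : nat -> {perm V}) :
  (forall i, i < K -> trivial_star (cell i)) ->
  (forall i, i < K -> [/\ walk (cell i) (F i) (F i.+1) (h i),
      walk (cell i) (F' i) (F' i.+1) (h' i),
      walk (cell i) (F i) (F' i) (v i)
    & walk (cell i) (F i.+1) (F' i.+1) (v i.+1)]) ->
  facet C (F 0%N) -> facet C (F' 0%N) -> walk finset.set0 (F 0%N) (F' 0%N) (v 0%N) ->
  forall m, m <= K -> [/\ walk finset.set0 (F 0%N) (F m) (\prod_(i < m) h i),
     walk finset.set0 (F' 0%N) (F' m) (\prod_(i < m) h' i)
   & eqv (F 0%N) (F' m) ((\prod_(i < m) h i) * v m) (v 0%N * \prod_(i < m) h' i)].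
Proof.
move=> tr wh fF fF' wv; elim=> [_|m IH mK].
  rewrite !big_ord0 mul1g mulg1; split; try by apply: walk1 => //; exact: finset.sub0set.
  exact: eqv_refl.
have [IH1 IH2 IH3] := IH (ltnW mK).
have [w1 w2 w3 w4] := wh m mK; have s0c := finset.sub0set (cell m).
rewrite !big_ord_recr /=; split.
- exact: walkM IH1 (walkS s0c w1).
- exact: walkM IH2 (walkS s0c w2).
rewrite -[X in eqv _ _ X]mulgA.
apply: (@eqv_trans _ _ ((\prod_(i < m) h i) * (v m * h' m))).
  apply: eqvM (eqv_refl IH1) _.
  exact: trivial_star_eqv (tr m mK) (walkM w1 w4) (walkM w3 w2).
by rewrite !mulgA; apply: eqvM IH3 (eqv_refl (walkS s0c w2)).
Qed.

(** The discrete form of a free null-homotopy: [h] and [v] are projectivities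
    along the horizontal and vertical edges of a grid, each cell is a loop in
    the star of one face, the left and right sides agree and the last row is
    constant. The first row is then conjugate to the last one, hence trivial. *)
Lemma grid_trivial (K J : nat) (F : nat -> nat -> {set V})
    (cell : nat -> nat -> {set V}) (h v : nat -> nat -> {perm V}) :
  (0 < K)%N ->
  (forall i j, i < K -> j < J -> trivial_star (cell i j)) ->
  (forall i j, i < K -> j < J ->
    [/\ walk (cell i j) (F i j) (F i.+1 j) (h i j),
      walk (cell i j) (F i j.+1) (F i.+1 j.+1) (h i j.+1),
      walk (cell i j) (F i j) (F i j.+1) (v i j)
    & walk (cell i j) (F i.+1 j) (F i.+1 j.+1) (v i.+1 j)]) ->
  (forall j, j <= J -> F K j = F 0%N j) -> (forall j, j < J -> v K j = v 0%N j) ->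
  (forall i, i < K -> h i J = 1) -> facet C (F 0%N 0%N) -> (0 < J)%N ->
  eqv (F 0%N 0%N) (F 0%N 0%N) (\prod_(i < K) h i 0%N) 1.
Proof.
move=> K0 tr wh FK vK hJ fF J0.
have fF' j : j <= J -> facet C (F 0%N j).
  case: j => // j jJ; have [_ _ + _] := wh 0%N j K0 jJ.
  by case/walk_facets.
suff H j : j <= J -> eqv (F 0%N (J - j)) (F 0%N (J - j)) (\prod_(i < K) h i (J - j)%N) 1.
  by have := H J (leqnn J); rewrite subnn.
elim: j => [_|j IH jJ].
  rewrite subn0 big1 => [|i _]; last by rewrite hJ.
  by apply: eqv_refl; apply: walk1; rewrite ?finset.sub0set ?fF'.
have {}IH := IH (ltnW jJ); set j' := (J - j.+1)%N.
have e : (J - j)%N = j'.+1 by rewrite /j' subnSK.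
rewrite e in IH.
have jJ' : j' < J by rewrite -e leq_subr.
have wv : walk finset.set0 (F 0%N j') (F 0%N j'.+1) (v 0%N j').
  by have [_ _ + _] := wh 0%N j' K0 jJ'; apply: walkS (finset.sub0set _).
have [w1 w2 eq] := @grid_row K (F^~ j') (F^~ j'.+1) (cell^~ j') (h^~ j') (h^~ j'.+1)
  (v^~ j')
   (fun i iK => tr i j' iK jJ') (fun i iK => wh i j' iK jJ')
   (fF' _ (ltnW jJ')) (fF' _ jJ') wv K (leqnn K).
rewrite /= (FK _ (ltnW jJ')) in w1.
rewrite /= (FK _ jJ') (vK _ jJ') in eq.
have e2 := eqv_trans eq (eqvM (eqv_refl wv) IH).
by have := eqvM e2 (eqv_refl (walkV wv)); rewrite mulg1 mulgK mulgV.
Qed.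

End Modulo.
End FacetPaths.

(** * Graphs with two neighbours at each vertex *)

Section TwoRegularGraphs.
Local Open Scope group_scope.
Variables (V : finType) (e : rel V).
Hypothesis e_sym : symmetric e.
Hypothesis e_irr : irreflexive e.
Hypothesis e_two : forall a b, e a b ->
  exists x y, x != y /\ forall z, e a z = (z == x) || (z == y).

Lemma no_three_neighbors a x y z : e a x -> e a y -> e a z ->
  x != y -> x != z -> y != z -> False.
Proof.
move=> ax ay az; have [u [v [_ H]]] := e_two ax.
move: ax ay az; rewrite !H.
by move=> /orP[] /eqP-> /orP[] /eqP-> /orP[] /eqP->; rewrite ?eqxx.
Qed.

(** Prepend neighbours as long as possible. *)
Lemma maximal_path a b : e a b -> exists x y p,
  [/\ path e x (y :: p), uniq [:: x, y & p]
    & forall z, e z x -> z \in [:: x, y & p]].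
Proof.
move=> ab.
have : exists x y p, path e x (y :: p) /\ uniq [:: x, y & p].
  exists a, b, [::]; rewrite /= ab !inE; split=> //.
  by rewrite andbT; apply: contraTneq ab => ->; rewrite e_irr.
case=> x [y [p]]; have [m] := ubnP (#|V| - size p)%N.
elim: m x y p => // m IH x y p lem [pth un].
have [H|] := pselect (forall z, e z x -> z \in [:: x, y & p]).
  by exists x, y, p.
case/existsNP => z /not_implyP[zx /negP zn].
apply: (IH z x (y :: p)); last first.
  by split; [move: pth; rewrite /= zx|move: un zn; rewrite cons_uniq => /= -> ->].
have : (size [:: z, x, y & p] <= #|V|)%N.
  by rewrite -(card_uniqP _) ?max_card // cons_uniq zn.
rewrite /= => le; move: lem; rewrite /= !ltnS; apply: leq_trans.
by rewrite ltn_sub2l // (leq_trans _ le) // ltnS leqW.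
Qed.

Lemma index_next (c : seq V) y : uniq c -> y \in c ->
  index (next c y) c = ((index y c).+1 %% size c)%N.
Proof.
case: c => // y0 c un yc; rewrite next_nth yc.
have := yc; rewrite -index_mem [size _]/= ltnS => le.
have E j : nth y0 c j = nth y0 (y0 :: c) j.+1 by [].
have [lt|ge] := ltnP (index y (y0 :: c)) (size c).
  by rewrite E index_uniq //= modn_small.
have ei : index y (y0 :: c) = size c by apply/eqP; rewrite eqn_leq le.
by rewrite ei nth_default //= eqxx modnn.
Qed.

Lemma next_neq_prev (c : seq V) y : uniq c -> 2 < size c -> y \in c ->
  next c y != prev c y.
Proof.
move=> un sz yc; apply/eqP => np.
have nc : next c y \in c by rewrite mem_next.
have : index (next c (next c y)) c = index y c by rewrite np next_prev.
rewrite !index_next // -[(_ %% _).+1]addn1 modnDml addn1.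
move: yc; rewrite -index_mem; move: (index y c) (size c) sz => i n n2 lt.
have [l2|ge] := ltnP i.+2 n; first by rewrite modn_small //; lia.
have [en|en] : n = i.+2 \/ n = i.+1 by lia.
  by rewrite en modnn; lia.
by rewrite -addn1 en modnDl modn_small; lia.
Qed.

(** A maximal path of a finite graph in which every vertex has two neighbours
    closes up to a cycle, as the second neighbour of its end lies on it. *)
Lemma cycle_of_two_regular a b : e a b -> exists c : seq V,
  [/\ uniq c, 2 < size c, path.cycle e c &
     forall y z, y \in c -> e y z = (z == next c y) || (z == prev c y)].
Proof.
case/maximal_path => x [y [p [pth un max]]].
have xy : e x y by case/andP: pth.
have [u [w [uw H]]] := e_two xy.
have [z zy xz] : exists2 z, z != y & e x z.
  have [euy|] := eqVneq u y; last by exists u => //; rewrite H eqxx.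
  by exists w; rewrite ?H ?eqxx ?orbT // -euy eq_sym.
have zx : z != x by apply: contraTneq xz => ->; rewrite e_irr.
have zp : z \in p.
  by have := max z; rewrite e_sym !inE (negPf zy) (negPf zx); apply.
have lz : last y p = z.
  case/splitPr: zp pth un => p1 [|t p2]; first by rewrite last_cat.
  move=> + un; have := un; rewrite -[x :: _]/([:: x, y & p1] ++ [:: z, t & p2]).
  rewrite cat_uniq => /and3P[/andP[xn _] /hasPn dis _].
  rewrite /= cat_path /= => /and4P[_ _ lz /andP[zt _]].
  have tn : t \notin [:: x, y & p1] by apply: dis; rewrite !inE eqxx orbT.
  exfalso; apply: (@no_three_neighbors z x (last y p1) t) => //.
  - by rewrite e_sym.
  - by rewrite e_sym.
  - by apply: contraNneq xn => ->; apply: mem_last.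
  - by apply: contraNneq tn => <-; rewrite inE eqxx.
  - by apply: contraNneq tn => <-; rewrite inE mem_last orbT.
exists [:: x, y & p]; have cyc : path.cycle e [:: x, y & p].
  by rewrite /path.cycle rcons_path pth /= lz e_sym.
have sz : 2 < size [:: x, y & p] by case: p zp {pth un max lz cyc}.
split=> // v t vc.
have en := next_cycle cyc vc; have := prev_cycle cyc vc; rewrite e_sym.
have [u' [w' [_ H']]] := e_two en; move: en; rewrite !H'.
have := next_neq_prev un sz vc.
by move=> /[swap] /orP[] /eqP-> /[swap] /orP[] /eqP->; rewrite ?eqxx // orbC.
Qed.
End TwoRegularGraphs.

Lemma subset_pair (V : finType) (t : {set V}) y z : t \subset [set y; z]%SET ->
  [\/ t = finset.set0, t = [set y]%SET, t = [set z]%SET | t = [set y; z]%SET].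
Proof.
move=> /fintype.subsetP sub.
have E x : x \in t = ((x == y) && (y \in t)) || ((x == z) && (z \in t)).
  apply/idP/idP => [xt|]; first by have := sub x xt; rewrite !inE => /orP[] /eqP e;
    rewrite -e eqxx xt ?orbT.
  by move=> /orP[] /andP[/eqP-> ->].
have [yt|yt] := boolP (y \in t); have [zt|zt] := boolP (z \in t).
- by constructor 4; apply/finset.setP => x; rewrite E yt zt !inE !andbT.
- by constructor 2; apply/finset.setP => x; rewrite E yt (negPf zt) !inE andbT andbF orbF.
- by constructor 3; apply/finset.setP => x; rewrite E zt (negPf yt) !inE andbT andbF.
- by constructor 1; apply/finset.setP => x; rewrite E (negPf zt) (negPf yt) !inE !andbF.
Qed.

Lemma order_tperm (V : finType) (a b : V) : a != b -> #[tperm a b]%g = 2.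
Proof.
move=> ab; apply: nt_prime_order => //; first by rewrite expgS expg1 tperm2.
by apply: contra ab => /eqP/permP/(_ a); rewrite tpermL perm1 => ->.
Qed.

(** * Pure complexes and faces of codimension 2 *)

Section PureComplexes.
Local Open Scope group_scope.
Variables (V : finType) (C : {set {set V}}) (d : nat).
Hypothesis complexC : simplicial_complex C.
Hypothesis pureC : forall f, facet C f -> #|f| = d.+1.
Implicit Types (s t u k f : {set V}).

Lemma face_facet s : s \in C -> exists2 f, facet C f & s \subset f.
Proof. by move=> sC; have [f [mf sf]] := @maxset_exists _ (fun t => t \in C) s sC;
  exists f. Qed.

Lemma facet_in f : facet C f -> f \in C.
Proof. by case/maxsetP. Qed.

Lemma face_sub s t : s \in C -> t \subset s -> t \in C.
Proof. by case: complexC => _; apply. Qed.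

Lemma mem_link k t : (t \in link C k) = [disjoint t & k] && (t :|: k \in C).
Proof.
rewrite inE andbC; have [dis|//] /= := boolP [disjoint t & k].
rewrite inE; apply/existsP/idP => [[f /and3P[fC kf tf]]|].
  by apply: (face_sub (facet_in fC)); rewrite finset.subUset tf.
by case/face_facet => f fC; rewrite finset.subUset => /andP[tf kf]; exists f; rewrite fC kf.
Qed.

Lemma facet_link k f : facet C f -> k \subset f -> f :\: k \in link C k.
Proof.
move=> fC kf; rewrite mem_link; apply/andP; split.
  rewrite -finset.setI_eq0; apply/eqP/finset.setP => x; rewrite !inE. by case: (x \in k);
    rewrite ?andbF.
apply: face_sub (facet_in fC) _.
by rewrite finset.subUset kf finset.subDset finset.subsetUr.
Qed.

Lemma facet_setD k f : facet C f -> k \subset f -> #|f :\: k| = (d.+1 - #|k|)%N.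
Proof. by move=> fC kf; rewrite cardsD (finset.setIidPr kf) pureC. Qed.

Lemma ridge_adjacent k s t : facet C s -> facet C t -> k \subset s -> k \subset t ->
  d <= #|k| -> s != t -> adjacent_facets s t.
Proof.
move=> fs ft ks kt dk st.
have kst : k \subset s :&: t by rewrite finset.subsetI ks.
have d1 : d <= #|s :&: t| := leq_trans dk (subset_leq_card kst).
have d2 : #|s :&: t| < d.+1.
  rewrite -(pureC fs) proper_card // properE finset.subsetIl /=.
  apply: contra st => sst; rewrite finset.eqEcard (pureC fs) (pureC ft) leqnn andbT.
  by apply: fintype.subset_trans sst (finset.subsetIr _ _).
have e : #|s :&: t| = d by apply/eqP; rewrite eqn_leq d1 andbT -ltnS.
by rewrite /adjacent_facets e (pureC fs) (pureC ft) eqxx.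
Qed.

Lemma ridge_connected k : d <= #|k| -> connected_star C k.
Proof.
move=> dk s t fs ft ks kt; have [->|st] := eqVneq s t; first by exists 1; apply: walk1.
by exists (perspectivity s t); apply: walk_step => //; apply: (@ridge_adjacent k).
Qed.

Lemma walk_setD k s t p x : walk C k s t p -> x \in s :\: k -> p x \in t :\: k.
Proof.
move=> w; case/finset.setDP => xs xk; apply/finset.setDP; split.
  by rewrite -(walk_imset w) imset_f.
by apply: contra xk => pk; rewrite -(perm_inj (walk_fix w pk)).
Qed.

(** The projectivity fixes [k] and at most one vertex of the facet is left. *)
Lemma ridge_trivial (s0 : {set V}) (N : {group {perm V}}) k : d <= #|k| ->
  trivial_star C s0 N k.
Proof.
move=> dk t p wp; apply: good1; first exact: walkS (finset.sub0set _) wp.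
have [_ _ ft kt] := walk_facets wp.
move=> x xt; have [xk|xk] := boolP (x \in k); first exact: walk_fix wp xk.
have xtk : x \in t :\: k by rewrite inE xk.
have := walk_setD wp xtk.
have : #|t :\: k| <= 1 by rewrite facet_setD // leq_subLR addn1 ltnS.
by move/card_le1_eqP; apply.
Qed.

Section Codim2.
Variable k : {set V}.
Hypothesis card_k : #|k|.+1 = d.
Hypothesis kC : k \in C.
Hypothesis connected_k : connected_star C k.
Hypothesis ridge_two : forall a, a \notin k -> a |: k \in C ->
  exists x y, x != y /\ forall z,
    ((z \notin a |: k) && (z |: (a |: k) \in C)) = (z == x) || (z == y).

Let e : rel V := fun a b => [&& a != b, a \notin k, b \notin k & b |: (a |: k) \in C].

Lemma codim2_facet f : facet C f -> k \subset f ->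
  exists a b, [/\ e a b, f :\: k = [set a; b]%SET & f = b |: (a |: k)].
Proof.
move=> fC kf; have /eqP/cards2P[a [b [ab fk]]] : #|f :\: k| = 2.
  by rewrite facet_setD // -card_k -addn2 addKn.
have ef : f = b |: (a |: k).
  apply/finset.setP => x; have := erefl (x \in f :\: k);
    rewrite {2}fk !inE orbA [(x == b) || _]orbC => <-.
  by have [xk|] := boolP (x \in k); rewrite ?orbT ?orbF //= (fintype.subsetP kf).
exists a, b; split=> //; rewrite /e ab -ef (facet_in fC) andbT.
have : a \in f :\: k by rewrite fk !inE eqxx.
have : b \in f :\: k by rewrite fk !inE eqxx orbT.
by rewrite !inE => /andP[-> _] /andP[-> _].
Qed.

Lemma adjacent_common f f' : facet C f -> adjacent_facets f f' ->
  exists z, z \in (f :&: f') :\: k.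
Proof.
move=> fC /andP[]; rewrite (pureC fC) eqSS => /eqP ffE _.
apply/set0Pn; rewrite -card_gt0 cardsD subn_gt0 ffE -card_k ltnS.
by rewrite subset_leq_card // finset.subsetIr.
Qed.

Lemma edge_sym : symmetric e.
Proof. by move=> a b; rewrite /e eq_sym finset.setUCA; congr (_ && _); case: (b \in k);
  case: (a \in k). Qed.

Lemma edge_irr : irreflexive e.
Proof. by move=> a; rewrite /e eqxx. Qed.

Lemma edge_two a b : e a b -> exists x y, x != y /\ forall z, e a z = (z == x) || (z == y).
Proof.
case/and4P => ab ak bk abC; have akC :
  a |: k \in C by apply: face_sub abC (finset.subsetUr _ _).
have [x [y [xy H]]] := ridge_two ak akC; exists x, y; split=> // z.
by rewrite -H /e ak /= !inE negb_or eq_sym -andbA.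
Qed.

Lemma edge_link a b : e a b -> [set a; b]%SET \in link C k.
Proof.
case/and4P => ab ak bk abC; rewrite mem_link; apply/andP; split.
  rewrite -finset.setI_eq0; apply/eqP/finset.setP => x; rewrite !inE.
  have [->|_] := eqVneq x a; first by rewrite (negPf ak) ?andbF.
  by have [->|_] := eqVneq x b; rewrite ?(negPf bk) ?andbF.
by rewrite -finset.setUA finset.setUCA.
Qed.

Lemma edge_exists : exists a b, e a b.
Proof. by have [f fC kf] := face_facet kC; have [a [b [ab _ _]]] := codim2_facet fC kf;
  exists a, b. Qed.

(** A cycle of the link contains, with one vertex, both of its neighbours; so
    the facets having a vertex on it are closed under adjacency, and these are
    all facets as the star is strongly connected. *)
Lemma link_cycle : exists c : seq V, [/\ uniq c, 2 < size c,
    forall y, y \in c -> e y (next c y) &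
    forall f, facet C f -> k \subset f -> exists y, y \in c /\ f :\: k = [set y;
      next c y]%SET].
Proof.
have [a0 [b0 ab0]] := edge_exists.
have [c [un sz cyc H]] := cycle_of_two_regular edge_sym edge_irr edge_two ab0.
exists c; split=> // [y yc|f fC kf]; first by rewrite H // eqxx.
have [y0 y0c] : exists y, y \in c by case: c sz {un cyc H} => // y ? _; exists y;
  apply: mem_head.
have ey0 : e y0 (next c y0) by rewrite H // eqxx.
suff : f :\: k \subset c.
  have [a [b [ab fk _]]] := codim2_facet fC kf.
  rewrite fk => /fintype.subsetP sub.
  have ac : a \in c by apply: sub; rewrite !inE eqxx.
  have bc : b \in c by apply: sub; rewrite !inE eqxx orbT.
  move: ab; rewrite (H _ _ ac) => /orP[] /eqP eb.
    by exists a; rewrite ac -eb.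
  by exists b; rewrite bc eb next_prev // finset.setUC.
have /and4P[_ _ _ y0C] := ey0.
have kC0 : next c y0 |: (y0 |: k) \in C by [].
have [f0 f0C sub0] := face_facet kC0.
have kf0 : k \subset f0.
  by apply: fintype.subset_trans sub0; rewrite finset.setUA finset.subsetUr.
have [p [g [gp lg _]]] := connected_k f0C fC kf0 kf.
have closed_c f' z : facet C f' -> k \subset f' -> z \in f' :\: k -> z \in c ->
  f' :\: k \subset c.
  move=> f'C kf'; have [a [b [ab -> _]]] := codim2_facet f'C kf'.
  have nb v w : e v w -> v \in c -> w \in c.
    by move=> vw vc; move: vw; rewrite H // => /orP[] /eqP->; rewrite ?mem_next ?mem_prev.
  have ba : e b a by rewrite edge_sym.
  move=> zab zc; apply/fintype.subsetP => x; move: zab zc.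
  rewrite !inE => /orP[] /eqP-> zc /orP[] /eqP-> //; first exact: nb ab zc.
  exact: nb ba zc.
have f0c : f0 :\: k \subset c.
  apply: (closed_c f0 y0) => //; case/and4P: ey0 => _ y0k _ _.
  rewrite inE y0k; apply: (fintype.subsetP sub0); by rewrite !inE eqxx orbT.
case/facet_path_starP: gp => gp adj; rewrite -lg.
elim: g f0 f0c f0C kf0 gp adj {sub0 lg} => [|f1 g IH] f0 //= f0c f0C kf0 gp /andP[f01 adj].
have [f1C kf1] := gp f1 (mem_behead (s := f0 :: f1 :: g) (mem_head _ _)).
apply: IH => // [|f2 f2g]; last by apply: gp; rewrite inE f2g orbT.
have [z] := adjacent_common f0C f01; rewrite !inE => /and3P[zk z0 z1].
apply: (closed_c f1 z) => //; first by rewrite inE zk.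
by apply: (fintype.subsetP f0c); rewrite inE zk.
Qed.
Lemma index_even_next (c : seq V) y : uniq c -> ~~ odd (size c) -> y \in c ->
  odd (index (next c y) c) = ~~ odd (index y c).
Proof.
move=> un ev yc; rewrite index_next //.
have := yc; rewrite -index_mem leq_eqVlt => /orP[/eqP ei|lt]; last by rewrite modn_small.
by rewrite ei modnn /=; move: ev; rewrite -ei /=; case: (odd _).
Qed.

(** For even [n] the parity of the position on the cycle is a proper colouring
    of the link. *)
Lemma link_ngon : exists2 n, ngon_boundary n (link C k) &
  ~~ odd n -> exists col : V -> bool, forall f x y, facet C f -> k \subset f ->
    x \in f :\: k -> y \in f :\: k -> x != y -> col x != col y.
Proof.
have [c [un sz cov' cov]] := link_cycle; exists (size c); last first.
  move=> ev; exists (fun x => odd (index x c)) => f x y fC kf.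
  have [z [zc ->]] := cov f fC kf; rewrite !inE.
  have nz := index_even_next un ev zc.
  by move=> /orP[] /eqP-> /orP[] /eqP->; rewrite ?eqxx // nz; case: odd.
have [x0 x0c] : exists y, y \in c by case: c sz {un cov' cov} => // y ? _; exists y;
  apply: mem_head.
split=> //; exists (fun i => nth x0 c i).
  by move=> i j /eqP; rewrite nth_uniq // => /eqP/val_inj.
have nS (i : 'I_(size c)) : nth x0 c (ordS i) = next c (nth x0 c i).
  have nc : next c (nth x0 c i) \in c by rewrite mem_next mem_nth.
  rewrite -[RHS](nth_index x0 nc).
  by rewrite index_next ?mem_nth // index_uniq.
apply/finset.setP => t; rewrite mem_link inE; apply/andP/orP => [[dis]|].
  case/face_facet => f fC; rewrite finset.subUset => /andP[tf kf].
  have [y [yc fk]] := cov f fC kf.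
  have : t \subset [set y; next c y]%SET.
    rewrite -fk; apply/fintype.subsetP => z zt; rewrite inE (fintype.subsetP tf) // andbT.
    by rewrite (disjointFr dis).
  have iy : index y c < size c by rewrite index_mem.
  have ey : nth x0 c (Ordinal iy) = y by rewrite /= nth_index.
  have iz : index (next c y) c < size c by rewrite index_mem mem_next.
  have ez : nth x0 c (Ordinal iz) = next c y by rewrite /= nth_index ?mem_next.
  case/subset_pair => ->; [left|right|right|right].
  - by rewrite eqxx.
  - by apply/existsP; exists (Ordinal iy); rewrite ey eqxx.
  - by apply/existsP; exists (Ordinal iz); rewrite ez eqxx.
  - by apply/existsP; exists (Ordinal iy); rewrite nS ey eqxx orbT.
have sub_edge y : y \in c -> t \subset [set y; next c y]%SET -> [disjoint t & k] /\
  t :|: k \in C.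
  move=> yc tsub; have := edge_link (cov' y yc); rewrite mem_link => /andP[dis eC].
  split; first exact: disjointWl tsub dis.
  by apply: face_sub eC _; apply: finset.setSU.
have key y : y \in c -> t \subset [set y; next c y]%SET ->
  [disjoint t & k] && (t :|: k \in C).
  by move=> yc /(sub_edge y yc)[-> ->].
move=> H; apply/andP; case: H => [/eqP et|/existsP[i]].
  by apply: (key x0) => //; rewrite et finset.sub0set.
case/orP => /eqP et; apply: (key (nth x0 c i)); rewrite ?mem_nth // et ?nS //.
by rewrite finset.sub1set !inE eqxx.
Qed.

(** Two adjacent facets share one vertex of the polygon; both vertices that the
    perspectivity exchanges have the colour opposite to that of this vertex. *)
Lemma even_walk (col : V -> bool) s t p :
  (forall f x y, facet C f -> k \subset f ->
    x \in f :\: k -> y \in f :\: k -> x != y -> col x != col y) ->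
  walk C k s t p -> {in s :\: k, forall x, col (p x) = col x}.
Proof.
move=> H [g [/facet_path_starP[gp adj] _ <-]].
elim: g s gp adj => [|u g IH] s gp /= => [_ x _|/andP[su adj] x xs].
  by rewrite path_projectivity_nil perm1.
have [sC ks] := gp s (mem_head _ _).
have [uC ku] := gp u (mem_behead (s := s :: u :: g) (mem_head _ _)).
rewrite path_projectivity_cons permM.
have step := walk_step sC uC ks ku su.
have gp' v : v \in u :: g -> facet C v /\ k \subset v by move=> vg; apply: gp;
  rewrite inE vg orbT.
rewrite (IH u gp' adj); last exact: walk_setD step xs.
have [xu|xu] := boolP (x \in u).
  by rewrite perspectivity_fixI //; case/finset.setDP: xs.
set y := perspectivity s u x; have yu : y \in u :\: k := walk_setD step xs.
have [z] := adjacent_common sC su; rewrite !inE => /and3P[zk zs zu].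
have xz : x != z by apply: contraNneq xu => ->.
have yz : y != z.
  apply: contra xz => /eqP yz; apply/eqP/(@perm_inj _ (perspectivity s u)).
  by rewrite -/y yz perspectivity_fixI.
have := H s x z sC ks xs _ xz; rewrite !inE zk zs => /(_ isT).
have := H u y z uC ku yu _ yz; rewrite !inE zk zu => /(_ isT).
by case: (col x); case: (col y); case: (col z).
Qed.

Lemma codim2_loop t : facet C t -> k \subset t -> exists a b,
  [/\ a != b, a \in t :\: k, b \in t :\: k &
    forall p, walk C k t t p -> restr_perm t p = 1 \/ restr_perm t p = tperm a b].
Proof.
move=> tC kt.
have [a [b [/and4P[ab ak bk _] tk et]]] := codim2_facet tC kt.
have atk : a \in t :\: k by rewrite tk !inE eqxx.
have btk : b \in t :\: k by rewrite tk !inE eqxx orbT.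
exists a, b; split=> // p w.
have := walk_setD w atk; have := walk_setD w btk; rewrite tk !inE.
have pab : p a != p b by rewrite (inj_eq perm_inj).
have inv x : x \in t -> [\/ x = a, x = b | x \in k].
  by rewrite {1}et !inE => /or3P[/eqP|/eqP|]; [constructor 2|constructor 1|constructor 3].
have pt : p \in 'N(t | 'P) by apply: imset_astabs; apply: walk_imset w.
have [aT _] := finset.setDP atk; have [bT _] := finset.setDP btk.
move=> H1; have [pa _|pa /=] := eqVneq (p a) a.
  move: pab; rewrite pa eq_sym => pab; move: H1; rewrite (negPf pab) /= => /eqP pb; left.
  apply/permP => x; rewrite perm1; have [xt|xt] := boolP (x \in t).
    by rewrite restr_permE //; case: (inv x xt) => [->|->|/(walk_fix w)].
  by rewrite (out_perm (restr_perm_on _ _)).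
move/eqP=> pa'; move: pab H1; rewrite pa' eq_sym => /negPf->; rewrite orbF => /eqP pb.
right; apply/permP => x; have [xt|xt] := boolP (x \in t); last first.
  rewrite (out_perm (restr_perm_on _ _)) // tpermD //; first by apply: contraNneq xt => <-.
  by apply: contraNneq xt => <-.
rewrite restr_permE //; case: (inv x xt) => [->|->|xk]; rewrite ?tpermL ?tpermR //.
by rewrite (walk_fix w) // tpermD //; [apply: contraNneq ak|apply: contraNneq bk] => ->.
Qed.

(** If a loop exchanges the two vertices outside of [k], which have different
    colours, then the polygon is odd, and the loop generates the whole group of
    projectivities of the star, which has at most these two elements. *)
Lemma codim2_trivial s0 : k != finset.set0 -> complex_size C = d.+1 ->
  trivial_star C s0 <<odd_generators C s0>>%G k.
Proof.
move=> k0 sizeC t p w; have [_ _ tC kt] := walk_facets w.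
have [a [b [ab ak bk H]]] := codim2_loop tC kt.
have pt : p \in 'N(t | 'P) by apply: imset_astabs; apply: walk_imset w.
have [aT _] := finset.setDP ak; have [bT _] := finset.setDP bk.
have w0 := walkS (finset.sub0set _) w.
case: (H p w) => rp.
  by apply: good1 => // x xt; rewrite -(restr_permE pt) // rp perm1.
have [n ngon even] := link_ngon; have [odd_n|/even[col colP]] := boolP (odd n); last first.
  have := even_walk colP w ak; rewrite -(restr_permE pt) // rp tpermL.
  by have := colP t a b tC kt ak bk ab; case: (col a); case: (col b).
move=> c [g [/facet_path_starP[gp adj] lg <-]]; have [l [lp ll lpi]] := w.
have [lpC adjl] := (facet_path_starP C k t l).1 lp.
apply: mem_gen; rewrite inE; apply/asboolP; exists g, k, l; rewrite lg.
have facets_g v : v \in s0 :: g -> facet C v by move=> /gp[].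
split=> //.
- by apply/andP; split=> //; apply/allP.
- by split=> //; split; [split=> //; rewrite sizeC card_k|exists n].
- by rewrite /facet_loop lp ll eqxx.
- rewrite /projectivity lpi rp cycle2g; last exact: order_tperm.
  apply/finset.setP => q; rewrite !inE; apply/orP/asboolP =>
    [[] /eqP->|[l' /andP[l'p /eqP l'l] ->]].
  + exists [::]; last by rewrite /projectivity path_projectivity_nil morph1.
    by case/andP: lp => /= /andP[fk _] _; rewrite /facet_loop /facet_path /= fk !eqxx.
  + by exists l; rewrite /facet_loop ?lp ?ll ?eqxx // /projectivity lpi.
  have w' : walk C k t t (path_projectivity t l') by exists l'.
  by case: (H _ w') => e'; rewrite /projectivity e' eqxx; [left|right].
rewrite /projectivity !path_projectivity_cat lg ll -lpi mulgA.
by rewrite -lg path_projectivity_inverse.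
Qed.

End Codim2.
(** Transport of a loop along a path is a conjugation inside the symmetric
    group of all vertices. *)
Lemma restr_permJ (s0 t : {set V}) a p : walk C finset.set0 s0 t a ->
  walk C finset.set0 t t p ->
  restr_perm s0 (a * p * a^-1) = restr_perm t p ^ a^-1.
Proof.
move=> wa wp; rewrite conjgE invgK; apply/permP => x.
have as0 y : (a y \in t) = (y \in s0) by rewrite -(walk_imset wa) mem_imset //;
  apply: perm_inj.
have pt : p \in 'N(t | 'P) by apply: imset_astabs; apply: walk_imset wp.
rewrite !permM; have [xs|xs] := boolP (x \in s0).
  by rewrite restr_permE ?(walk_astabs wa) // !permM restr_permE ?as0.
by rewrite !(out_perm (restr_perm_on _ _)) ?as0 // permK.
Qed.

Lemma odd_generator_transposition (s0 : {set V}) p : complex_size C = d.+1 ->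
  p \in odd_generators C s0 -> p = 1 \/ transposition s0 p.
Proof.
move=> sizeC; rewrite inE => /asboolP[g [k [l [gp [[[kC k0 ck] _] ks] lp _ ->]]]].
have {}ck : #|k|.+1 = d by move: ck; rewrite sizeC => -[].
have [lpC /eqP ll] := andP lp.
set t := last s0 g in lp lpC ll ks *.
have wl : walk C k t t (path_projectivity t l) by exists l.
have wg : walk C finset.set0 s0 t (path_projectivity s0 g).
  by exists g; split=> //; rewrite facet_path_star0.
have [_ _ tC kt] := walk_facets wl.
have [a [b [ab ak bk H]]] := codim2_loop ck tC kt.
rewrite /projectivity !path_projectivity_cat -/t ll path_projectivity_inverse;
  last by case/andP: gp.
rewrite mulgA (restr_permJ wg (walkS (finset.sub0set _) wl)).
move: (path_projectivity s0 g) wg => c wg.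
have bs y : y \in t -> c^-1 y \in s0.
  by move=> yt; rewrite -(walk_imset (walkV wg)) imset_f.
case: (H _ wl) => ->; first by left; rewrite conj1g.
right; rewrite tpermJ; eexists; eexists; split; last by [].
- by apply: bs; case/finset.setDP: ak.
- by apply: bs; case/finset.setDP: bk.
- by rewrite (inj_eq perm_inj).
Qed.
End PureComplexes.

(** * Continuity *)

Import Order.TTheory GRing.Theory Num.Theory.
Import numFieldNormedType.Exports.

Section Topo.
Local Open Scope classical_set_scope.
Local Open Scope ring_scope.
Variable R : realType.

Lemma continuous_row (T : topologicalType) n (f : T -> 'rV[R]_n) :
  (forall j, continuous (fun z => f z 0 j)) -> continuous f.
Proof.
move=> cf z; apply/cvg_ballP => e e0.
have : \forall x \near z, forall j, ball (f z 0 j) e (f x 0 j).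
  apply: (@filter_forall _ _ (fun j x => ball (f z 0 j) e (f x 0 j))) => j.
  exact: (cvg_ball (cf j z) e0).
apply: filterS => x H; split=> // i j; by rewrite !ord1.
Qed.

Lemma continuous_coord (T : topologicalType) n (f : T -> 'rV[R]_n) j :
  continuous f -> continuous (fun z => f z 0 j).
Proof. move=> cf z; apply: (@continuous_comp _ _ _ f (fun M : 'rV[R]_n => M 0 j)).
  exact: cf.
exact: coord_continuous. Qed.

(** Continuity relative to a subset is turned into continuity as soon as the
    inner map stays in the subset; all homotopies below are therefore given as
    maps on the whole plane with values in the space in question. *)
Lemma within_comp (X Y Z : topologicalType) (A : set Y) (f : Y -> Z) (c : X -> Y) :
  {within A, continuous f} -> continuous c -> (forall x, A (c x)) -> continuous (f \o c).
Proof.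
move=> /subspace_continuousP cf cc Ac x U fU.
have nb : nbhs (c x) [set y | A y -> U (f y)] := cf (c x) (Ac x) U fU.
have nbx : nbhs x [set y | A (c y) -> U (f (c y))] := cc x _ nb.
by apply: (filterS _ nbx) => y /(_ (Ac y)).
Qed.

Definition clamp01 (t : R) : R := Num.max 0 (Num.min 1 t).

Lemma continuous_after (X Y Z : topologicalType) (f : X -> Y) (g : Y -> Z) :
  continuous g -> continuous f -> continuous (fun x => g (f x)).
Proof. by move=> cg cf x; exact: (@continuous_comp X Y Z f g x (cf x) (cg (f x))). Qed.

Lemma continuous_fst (X Y : topologicalType) : continuous (fun z : X * Y => z.1).
Proof. by move=> z; exact: cvg_fst. Qed.

Lemma continuous_snd (X Y : topologicalType) : continuous (fun z : X * Y => z.2).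
Proof. by move=> z; exact: cvg_snd. Qed.

Section RealContinuity.
Variable X : topologicalType.
Implicit Types f g : X -> R.

Lemma continuous_cst (c : R) : continuous (fun _ : X => c).
Proof. by move=> x; exact: cvg_cst. Qed.

Lemma continuous_add f g : continuous f -> continuous g -> continuous (fun x => f x + g x).
Proof. by move=> cf cg x; apply: cvgD; [exact: cf|exact: cg]. Qed.

Lemma continuous_sub f g : continuous f -> continuous g -> continuous (fun x => f x - g x).
Proof. by move=> cf cg x; apply: cvgB; [exact: cf|exact: cg]. Qed.

Lemma continuous_mul f g : continuous f -> continuous g -> continuous (fun x => f x * g x).
Proof. by move=> cf cg x; apply: cvgM; [exact: cf|exact: cg]. Qed.

Lemma continuous_inv f : (forall x, f x != 0) -> continuous f -> continuous (fun x =>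
  (f x)^-1).
Proof. by move=> f0 cf x; apply: cvgV; [exact: f0|exact: cf]. Qed.

Lemma continuous_maxr f g : continuous f -> continuous g -> continuous (fun x =>
  Num.max (f x) (g x)).
Proof. by move=> cf cg x; exact: (@continuous_max R X f g x (cf x) (cg x)). Qed.

Lemma continuous_minr f g : continuous f -> continuous g -> continuous (fun x =>
  Num.min (f x) (g x)).
Proof. by move=> cf cg x; exact: (@continuous_min R X f g x (cf x) (cg x)). Qed.

Lemma continuous_clamp f : continuous f -> continuous (fun x => clamp01 (f x)).
Proof.
move=> cf; apply: continuous_maxr; first exact: continuous_cst.
by apply: continuous_minr => //; exact: continuous_cst.
Qed.

Lemma continuous_sum n (F : 'I_n -> X -> R) : (forall i, continuous (F i)) ->
  continuous (fun x => \sum_i F i x).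
Proof.
move=> cF; elim: n F cF => [|n IH] F cF.
  by under eq_fun do rewrite big_ord0; exact: continuous_cst.
under eq_fun do rewrite big_ord_recr /=.
by apply: continuous_add => //; apply: IH.
Qed.

Lemma continuous_sqrtr f : continuous f -> continuous (fun x => Num.sqrt (f x)).
Proof. by move=> cf x; apply: continuous_comp (cf x) _; exact: sqrt_continuous. Qed.
End RealContinuity.

Lemma clamp01_itv t : 0 <= clamp01 t <= 1.
Proof. by rewrite /clamp01 le_max lexx /= ge_max ler01 ge_min lexx. Qed.

Lemma clamp01_id t : 0 <= t <= 1 -> clamp01 t = t.
Proof. by move=> /andP[t0 t1]; rewrite /clamp01 min_r // max_r. Qed.

(** Uniform continuity on the unit square, by compactness. *)
Lemma square_unif n (f : R * R -> 'rV[R]_n) (e : R) : continuous f -> 0 < e ->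
  exists2 d : R, 0 < d & forall x y : R * R, 0 <= x.1 <= 1 -> 0 <= x.2 <= 1 ->
    `|x.1 - y.1| < d -> `|x.2 - y.2| < d -> forall j, `|f x 0 j - f y 0 j| < e.
Proof.
move=> cf e0.
have cK : compact (`[0, 1]%classic `*` `[0, 1]%classic : set (R * R)).
  by apply: compact_setX; exact: segment_compact.
pose P (d : R) (x : R * R) := forall y : R * R, `|x.1 - y.1| < d -> `|x.2 - y.2| < d ->
   forall j, `|f x 0 j - f y 0 j| < e.
have : \forall d \near 0^'+, (`[0, 1]%classic `*` `[0, 1]%classic : set (R * R)) `<=` P d.
  apply: ((compact_near_coveringP _).1 cK _ _ (fun d x => P d x)) => x _.
  have [r r0 rf] : exists2 r : R, 0 < r & forall y, ball x r y ->
    forall j, `|f x 0 j - f y 0 j| < e / 2.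
    have e20 : 0 < e / 2 by lra.
    have nb : nbhs x [set y | ball (f x) (e / 2) (f y)] by exact: (cvg_ball (cf x) e20).
    have [r r0 H] := (nbhs_ballP x _).1 nb.
    exists r => // y /H[_ H'] j.
    exact: H'.
  have r20 : 0 < r / 2 by lra.
  exists (ball x (r / 2), [set d | d < r / 2]).
    by split; [exact: nbhsx_ballx|exact: nbhs_right_lt].
  move=> [x' d] /= [[b1 b2] dr] y y1 y2 j.
  have h1 : `|f x 0 j - f x' 0 j| < e / 2.
    by apply: rf; apply: (@le_ball _ _ _ (r/2)); [lra|split].
  have h2 : `|f x 0 j - f y 0 j| < e / 2.
    have b1' : `|x.1 - x'.1| < r / 2 := b1; have b2' : `|x.2 - x'.2| < r / 2 := b2.
    apply: rf; have c1 : `|x.1 - y.1| < r by move: b1' y1; rewrite !ltr_norml; lra.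
    have c2 : `|x.2 - y.2| < r by move: b2' y2; rewrite !ltr_norml; lra.
    by split; [exact: c1|exact: c2].
  by move: h1 h2; rewrite !ltr_norml; lra.
move=> H; near (0 : R)^'+ => d; exists d; first by near: d; exact: nbhs_right_gt.
move=> x y x1 x2 y1 y2; apply: (near H d) => //=; by rewrite !in_itv /= x1 x2.
Unshelve. all: by end_near.
Qed.

End Topo.

(** * Polygonal paths *)

Section Polygons.
Local Open Scope ring_scope.
Variables (R : realType) (m : nat).
Implicit Types (x q : 'rV[R]_m) (s : seq 'rV[R]_m).

Lemma locate (N : nat) (y : R) : (0 < N)%N -> 0 <= y <= N%:R ->
  exists2 i : nat, (i < N)%N & i%:R <= y <= i.+1%:R.
Proof.
elim: N => // N IH _ /andP[y0 yN]; have [Ny|yN'] := leP N%:R y; first by exists N;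
  rewrite ?Ny.
case: N IH yN yN' => [|N] IH yN yN'; first by move: y0; rewrite leNgt yN'.
by have [i iN ih] := IH isT (introT andP (conj y0 (ltW yN'))); exists i => //; exact: ltnW.
Qed.

(** On the [i]-th segment the earlier clamps equal 1, so that their terms
    telescope to the [i]-th vertex, and the later ones vanish. *)
Lemma polygonal_pathE x s t i : (i < size s)%N -> i%:R <= (size s)%:R * t <= i.+1%:R ->
  polygonal_path x s t = nth 0 (x :: s) i +
    ((size s)%:R * t - i%:R) *: (nth 0 s i - nth 0 (x :: s) i).
Proof.
move=> iN; rewrite /polygonal_path; set y := _ * t => /andP[iy yi].
rewrite -(big_mkord xpredT (fun j =>
  Num.max 0 (Num.min 1 (y - j%:R)) *: (nth 0 s j - nth 0 (x :: s) j))).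
rewrite (big_cat_nat (n := i)) //=; last exact: ltnW.
rewrite (@big_ltn _ _ _ i (size s)) // [X in _ + (_ + (_ + X))]big1_seq; last first.
  move=> j; rewrite mem_index_iota => /andP[_ /andP[ij _]].
  have : i.+1%:R <= j%:R :> R by rewrite ler_nat.
  move=> h; rewrite max_l ?scale0r // ge_min; apply/orP; right; lra.
rewrite addr0 addrA; congr (_ + _ *: _); last first.
  move: yi; rewrite -natr1 => yi; rewrite min_r ?max_r //; lra.
rewrite (eq_big_nat _ _ (F2 := fun j => nth 0 (x :: s) j.+1 - nth 0 (x :: s) j));
  last first.
  move=> j /andP[_ ji]; have : j.+1%:R <= i%:R :> R by rewrite ler_nat.
  by rewrite -natr1 => h; rewrite min_l ?max_r ?scale1r //; lra.
by rewrite telescope_sumr //= addrC subrK.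
Qed.

Lemma polygonal_path_segment x s t : (0 < size s)%N -> 0 <= t <= 1 ->
  exists i th, [/\ (i < size s)%N, 0 <= th <= 1, (size s)%:R * t = i%:R + th &
    polygonal_path x s t = (1 - th) *: nth 0 (x :: s) i + th *: nth 0 s i].
Proof.
move=> s0 /andP[t0 t1].
have h : 0 <= (size s)%:R * t <= (size s)%:R.
  by rewrite mulr_ge0 ?ler0n // ler_piMr.
have [i iN ih] := locate s0 h.
exists i, ((size s)%:R * t - i%:R); split=> //.
- by case/andP: ih; rewrite -natr1; lra.
- by rewrite addrC subrK.
by rewrite (polygonal_pathE x iN ih); set th := (X in X *: _);
  rewrite scalerBr [(1 - _) *: _]scalerBl scale1r addrA addrAC.
Qed.

Lemma polygonal_path0 x s : polygonal_path x s 0 = x.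
Proof.
rewrite /polygonal_path big1 ?addr0 // => i _.
by rewrite mulr0 sub0r max_l ?scale0r // ge_min oppr_le0 ler0n orbT.
Qed.

Lemma polygonal_path1 x s : polygonal_path x s 1 = last x s.
Proof.
have [s0|s0] := posnP (size s).
  by rewrite /polygonal_path; case: s s0 => //= _; rewrite big_ord0 addr0.
rewrite (@polygonal_pathE _ _ _ (size s).-1); first last.
- by rewrite prednK // mulr1 lexx andbT ler_nat leq_pred.
- by rewrite prednK.
have -> : (size s)%:R * 1 - (size s).-1%:R = 1 :> R.
  by rewrite mulr1 -{1}(prednK s0) -natr1 addrC addKr.
by rewrite scale1r addrC subrK nth_last; case: s s0.
Qed.

Lemma continuous_polygonal_path x s : continuous (polygonal_path x s).
Proof.
apply: continuous_row => j.
have -> : (fun t => polygonal_path x s t 0 j) = (fun t : R => x 0 j +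
   \sum_(i < size s) clamp01 ((size s)%:R * t - i%:R) * (nth 0 s i - nth 0 (x :: s) i) 0 j).
  by apply/funext => t; rewrite mxE summxE; congr (_ + _); apply: eq_bigr => i _;
    rewrite mxE.
apply: continuous_add; first exact: continuous_cst.
apply: continuous_sum => i; apply: continuous_mul; last exact: continuous_cst.
apply: continuous_clamp; apply: continuous_sub; last exact: continuous_cst.
by apply: continuous_mul; [exact: continuous_cst|move=> ?; exact: cvg_id].
Qed.

End Polygons.

(** * Paths and loops in spheres *)

Section Spheres.
Local Open Scope ring_scope.
Variables (R : realType) (m : nat).
Implicit Types (x y q a b : 'rV[R]_m).

Lemma exists_normal r (M : 'M[R]_(r, m)) : (r < m)%N -> exists2 n :
  'cV[R]_m, n != 0 & M *m n = 0.
Proof.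
move=> rm; have /eqP ck : cokermx M != 0.
  by rewrite -mxrank_eq0 mxrank_coker subn_eq0 -ltnNge (leq_ltn_trans (rank_leq_row _)).
have [j cj] : exists j, col j (cokermx M) != 0.
  apply/existsP; apply: contra_notT ck => /existsPn H.
  by apply/matrixP => i j; have := H j; rewrite negbK => /eqP/matrixP/(_ i 0); rewrite !mxE.
exists (col j (cokermx M)) => //; rewrite colE mulmxA mulmx_coker mul0mx //.
Qed.

Lemma exists_normal2 a b : (2 < m)%N -> exists n : 'cV[R]_m, [/\ n != 0,
  a *m n = 0 & b *m n = 0].
Proof.
move=> m2; have [n n0] := exists_normal (col_mx a b) m2.
rewrite mul_col_mx -[0]vsubmxK => /eq_col_mx[an bn]; exists n; split=> //.
  by rewrite an; apply/matrixP => i j; rewrite !mxE.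
by rewrite bn; apply/matrixP => i j; rewrite !mxE.
Qed.

Lemma exists_normal1 a : (1 < m)%N -> exists n : 'cV[R]_m, n != 0 /\ a *m n = 0.
Proof. by move=> m1; have [n n0 an] := exists_normal a m1; exists n. Qed.

Lemma poly_nonroot (p : {poly R}) : p != 0 -> exists z, ~~ root p z.
Proof.
move=> p0; apply: contrapT => H.
have : (size [seq (i%:R : R) | i <- iota 0 (size p)] < size p)%N.
  apply: max_poly_roots => //.
    by apply/allP => z _; apply: contrapT => /negP nz; apply: H; exists z.
  by rewrite map_inj_uniq ?iota_uniq // => i j /eqP; rewrite eqr_nat => /eqP.
by rewrite size_map size_iota ltnn.
Qed.

(** The product of the polynomials describing the hyperplanes along the moment
    curve is not zero, so some point of the curve avoids all of them. *)
Lemma avoid_hyperplanes (s : seq 'cV[R]_m) : (forall n, n \in s -> n != 0) ->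
  exists q : 'rV[R]_m, forall n, n \in s -> q *m n != 0.
Proof.
move=> s0; pose P (n : 'cV[R]_m) : {poly R} := \sum_j n j 0 *: 'X^j.
have P0 n : n \in s -> P n != 0.
  move=> /s0; apply: contra => /eqP h; apply/eqP/matrixP => i j; rewrite ord1 [RHS]mxE.
  have := coef0 R i; rewrite -h coef_sum (bigD1 i) //= coefZ coefXn eqxx mulr1 big1
    ?addr0 // => k ki.
  by rewrite coefZ coefXn eq_sym [(_ == _)%N](negPf ki) mulr0.
have : \prod_(p <- [seq P n | n <- s]) p != 0.
  by rewrite prodf_seq_neq0; apply/allP => _ /mapP[n /P0 ? ->].
case/poly_nonroot => z; rewrite root_bigmul => /allP H.
exists (\row_j z ^+ j) => n ns; apply: contra (H _ (map_f P ns)) => /eqP/matrixP/(_ 0 0).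
rewrite !mxE /root horner_sum => h; rewrite -[X in _ == X]h; apply/eqP.
by apply: eq_bigr => j _; rewrite !mxE hornerZ hornerXn mulrC.
Qed.

Definition dot x y : R := \sum_i x 0 i * y 0 i.

Lemma unit_sphereE x : unit_sphere x <-> dot x x = 1.
Proof. by rewrite /unit_sphere /dot /=; split=> <-; apply: eq_bigr => i _; rewrite expr2.
  Qed.

Lemma dot_ge0 x : 0 <= dot x x.
Proof. by apply: sumr_ge0 => i _; rewrite -expr2 sqr_ge0. Qed.

Lemma dot_eq0 x : (dot x x == 0) = (x == 0).
Proof.
apply/eqP/eqP => [|->]; last by rewrite /dot big1 // => i _; rewrite mxE mul0r.
move=> h; apply/rowP => i; rewrite mxE; apply/eqP; rewrite -sqrf_eq0 expr2; apply/eqP.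
have := @psumr_eq0P R _ xpredT (fun i => x 0 i * x 0 i) _ h; apply=> // j _.
by rewrite -expr2 sqr_ge0.
Qed.

Lemma dot_comb u v x y z : dot (u *: x + v *: y) z = u * dot x z + v * dot y z.
Proof. by rewrite /dot !mulr_sumr -big_split /=; apply: eq_bigr => i _; rewrite !mxE;
  ring. Qed.

Definition normalize x : 'rV[R]_m := (Num.sqrt (dot x x))^-1 *: x.

Lemma normalize_sphere x : x != 0 -> unit_sphere (normalize x).
Proof.
move=> x0; apply/unit_sphereE.
have d0 : 0 < dot x x by rewrite lt_def dot_eq0 x0 dot_ge0.
have s0 : Num.sqrt (dot x x) != 0 by rewrite gt_eqF // sqrtr_gt0.
have -> : dot (normalize x) (normalize x) = (Num.sqrt (dot x x))^-1 ^+ 2 * dot x x.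
  by rewrite /dot /normalize mulr_sumr; apply: eq_bigr => i _; rewrite !mxE; ring.
by rewrite -{2}(sqr_sqrtr (ltW d0)) -exprMn mulVf // expr1n.
Qed.

Lemma normalize_id x : unit_sphere x -> normalize x = x.
Proof. by move/unit_sphereE => h; rewrite /normalize h sqrtr1 invr1 scale1r. Qed.

Lemma sphere_neq0 x : unit_sphere x -> x != 0.
Proof. by move/unit_sphereE => h; rewrite -dot_eq0 h oner_eq0. Qed.

Lemma continuous_normalize (X : topologicalType) (f : X -> 'rV[R]_m) :
  continuous f -> (forall z, f z != 0) -> continuous (fun z => normalize (f z)).
Proof.
move=> cf f0; apply: continuous_row => j.
have -> : (fun z => normalize (f z) 0 j) = (fun z => (Num.sqrt (dot (f z)
  (f z)))^-1 * f z 0 j).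
  by apply/funext => z; rewrite mxE.
apply: continuous_mul; last exact: continuous_coord.
apply: continuous_inv.
  move=> z; rewrite gt_eqF // sqrtr_gt0 lt_def dot_eq0 f0; exact: dot_ge0.
apply: continuous_sqrtr; apply: continuous_sum => i.
by apply: continuous_mul; exact: continuous_coord.
Qed.

Lemma continuous_comb (X : topologicalType) (u v : X -> R) (f g : X -> 'rV[R]_m) :
  continuous u -> continuous v -> continuous f -> continuous g ->
  continuous (fun z => u z *: f z + v z *: g z).
Proof.
move=> cu cv cf cg; apply: continuous_row => j.
have -> : (fun z => (u z *: f z + v z *: g z) 0 j) = (fun z =>
  u z * f z 0 j + v z * g z 0 j).
  by apply/funext => z; rewrite !mxE.
by apply: continuous_add; apply: continuous_mul => //; exact: continuous_coord.
Qed.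

(** The polygon from [a] to [b] through a vector [q] on neither of the lines
    spanned by [a] and [b] misses the origin. *)
Lemma sphere_path a b : (1 < m)%N -> unit_sphere a -> unit_sphere b ->
  exists c : R -> 'rV[R]_m, [/\ continuous c, forall t, unit_sphere (c t),
    c 0 = a & c 1 = b].
Proof.
move=> m1 Sa Sb.
have [n1 [n10 an1]] := exists_normal1 a m1; have [n2 [n20 bn2]] := exists_normal1 b m1.
have [|q qn] := @avoid_hyperplanes [:: n1; n2].
  by move=> n; rewrite !inE => /orP[] /eqP->.
have qn1 : q *m n1 != 0 by apply: qn; rewrite !inE eqxx.
have qn2 : q *m n2 != 0 by apply: qn; rewrite !inE eqxx orbT.
pose p t := polygonal_path a [:: q; b] (clamp01 t).
have comb0 (y : 'rV[R]_m) (n : 'cV[R]_m) (u v : R) : y != 0 -> y *m n = 0 ->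
  q *m n != 0 -> u + v = 1 ->
    u *: y + v *: q != 0.
  move=> y0 yn qn0 uv; have [v0|v0] := eqVneq v 0.
    by rewrite v0 scale0r addr0 (_ : u = 1) ?scale1r // -uv v0 addr0.
  apply: contra qn0 => /eqP/(congr1 (mulmx^~ n)) /=.
  rewrite mulmxDl -!scalemxAl yn scaler0 add0r mul0mx => /eqP.
  by rewrite scaler_eq0 (negPf v0).
have p0 t : p t != 0.
  rewrite /p.
  have [i [th [iN th01 _ ->]]] := polygonal_path_segment a (isT : (0 < size [:: q;
    b])%N) (clamp01_itv t).
  case: i iN => [|[|//]] _ /=; first by apply: (comb0 a n1) => //;
    [exact: sphere_neq0|rewrite subrK].
  by rewrite addrC; apply: (comb0 b n2) => //; [exact: sphere_neq0|rewrite addrC subrK].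
exists (fun t => normalize (p t)); split.
- apply: continuous_normalize => //.
  move=> t; apply: continuous_comp; last exact: continuous_polygonal_path.
  by apply: continuous_clamp => ?; exact: cvg_id.
- by move=> t; exact: normalize_sphere.
- by rewrite /p clamp01_id ?lexx ?ler01 // polygonal_path0 normalize_id.
- by rewrite /p clamp01_id ?lexx ?ler01 // polygonal_path1 normalize_id.
Qed.

(** The square of the Euclidean distance of unit vectors is
    [2 - 2 * dot x y]. *)
Lemma dot_close x y (e : R) : unit_sphere x -> unit_sphere y -> 0 < e ->
  m%:R * e ^+ 2 < 2 ->
  (forall j, `|x 0 j - y 0 j| < e) -> 0 < dot x y.
Proof.
move=> /unit_sphereE Sx /unit_sphereE Sy e0 me close.
have h : \sum_(j < m) (x 0 j - y 0 j) ^+ 2 <= m%:R * e ^+ 2.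
  have -> : m%:R * e ^+ 2 = \sum_(j < m) e ^+ 2 by rewrite sumr_const card_ord mulr_natl.
  apply: ler_sum => j _; rewrite -real_normK ?num_real // lerXn2r ?nnegrE ?(ltW e0) //.
  exact: ltW.
have : \sum_(j < m) (x 0 j - y 0 j) ^+ 2 = dot x x + dot y y - (dot x y + dot x y).
  by rewrite /dot -!big_split -sumrB /=; apply: eq_bigr => j _; ring.
by rewrite Sx Sy => h2; move: h; rewrite h2; lra.
Qed.

(** The loop is close to an inscribed polygon, whose sides span finitely many
    planes through the origin. As these do not cover the space there is a
    vector [q] outside of them, and no segment from the polygon to [q] meets
    the origin. Radial projection of the straight homotopies from the loop to
    the polygon, and from there to [q], contracts the loop. *)
Lemma sphere_contract (c : R -> 'rV[R]_m) : (2 < m)%N -> continuous c ->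
  (forall t, unit_sphere (c t)) -> c 0 = c 1 ->
  exists H : R * R -> 'rV[R]_m, [/\ continuous H, forall z, unit_sphere (H z),
    forall t, 0 <= t <= 1 -> H (t, 0) = c t,
    forall u, H (0, u) = H (1, u) & forall t, H (t, 1) = H (0, 1)].
Proof.
move=> m2 cc Sc c01.
have m0 : 0 < m%:R :> R by rewrite ltr0n (leq_trans _ m2).
have e0 : 0 < (m%:R : R)^-1 by rewrite invr_gt0.
have cf : continuous (fun z : R * R => c z.1).
  exact: continuous_after cc (@continuous_fst _ _).
have [d d0 unif] := square_unif cf e0.
have close (s t : R) : 0 <= s <= 1 -> `|s - t| < d -> 0 < dot (c s) (c t).
  move=> s01 st; apply: (@dot_close _ _ m%:R^-1) => //.
    rewrite expr2 mulrA divff ?gt_eqF // mul1r.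
    by rewrite (@le_lt_trans _ _ 1) ?ltr1n // invf_le1 // ler1n (leq_trans _ m2).
  by move=> j; apply: (unif (s, 0) (t, 0)) => //=; rewrite ?lexx ?ler01 // subrr normr0.
have [N N0 Nd] : exists2 N : nat, (0 < N)%N & N%:R^-1 < d.
  have := truncnS_gt d^-1; set N := (Num.truncn d^-1).+1 => dN; exists N => //.
  by rewrite -[d]invrK ltf_pV2 ?posrE ?invr_gt0 // ltr0n.
have N0' : 0 < N%:R :> R by rewrite ltr0n.
pose pts := [seq c (i.+1%:R / N%:R) | i <- iota 0 N].
have spts : size pts = N by rewrite size_map size_iota.
have nthc i : (i <= N)%N -> nth 0 (c 0 :: pts) i = c (i%:R / N%:R).
  case: i => [|i] iN /=; first by rewrite mul0r.
  by rewrite (nth_map 0%N) ?size_iota // nth_iota.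
have [nrm nrmP] := choice (fun i : 'I_N => exists_normal2 (c (i%:R / N%:R))
  (c (i.+1%:R / N%:R)) m2).
have [|q qn] := @avoid_hyperplanes [seq nrm i | i <- enum 'I_N].
  by move=> _ /mapP[i _ ->]; have [] := nrmP i.
pose p t := polygonal_path (c 0) pts t.
have pE t : 0 <= t <= 1 -> (exists2 n : 'cV[R]_m, p t *m n = 0 & q *m n != 0) /\
  0 < dot (p t) (c t).
  move=> t01; have s0 : (0 < size pts)%N by rewrite spts.
  have [i [th [iN th01 Nt pt]]] := polygonal_path_segment (c 0) s0 t01.
  rewrite spts in iN Nt.
  have tE : t = i%:R / N%:R + th / N%:R by rewrite -mulrDl -Nt mulrAC divff ?gt_eqF //
    mul1r.
  have := nthc i.+1 iN; rewrite /= => nS.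
  have {}pt : p t = (1 - th) *: c (i%:R / N%:R) + th *: c (i.+1%:R / N%:R).
    by rewrite /p pt nS nthc // ltnW.
  split.
    exists (nrm (Ordinal iN)); last by apply: qn; apply: map_f; rewrite mem_enum.
    have [_ /= k1 k2] := nrmP (Ordinal iN).
    by rewrite pt mulmxDl -!scalemxAl k1 k2 !scaler0 addr0.
  have /andP[th0 th1] := th01.
  have thN : 0 <= th / N%:R <= N%:R^-1.
    apply/andP; split; first by apply: divr_ge0 => //; exact: ltW.
    by rewrite ler_pdivrMr // mulVf ?gt_eqF.
  have iN01 (j : nat) : (j <= N)%N -> 0 <= (j%:R / N%:R : R) <= 1.
    by move=> jN; apply/andP; split; rewrite ?ler_pdivrMr ?mul1r ?ler_nat //;
      apply: divr_ge0; rewrite ler0n.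
  have SE : i.+1%:R / N%:R = i%:R / N%:R + N%:R^-1 :> R by rewrite -natr1 mulrDl mul1r.
  have d1 : 0 < dot (c (i%:R / N%:R)) (c t).
    apply: close; first by apply: iN01; exact: ltnW.
    by rewrite tE opprD addrA subrr sub0r normrN ger0_norm; lra.
  have d2 : 0 < dot (c (i.+1%:R / N%:R)) (c t).
    apply: close; first exact: iN01.
    by rewrite tE SE ger0_norm; lra.
  rewrite pt dot_comb.
  have [->|thn] := eqVneq th 1; first by rewrite subrr mul0r add0r mul1r.
  have h1 : 0 < (1 - th) * dot (c (i%:R / N%:R))
    (c t) by rewrite mulr_gt0 // subr_gt0 lt_neqAle thn.
  have h2 : 0 <= th * dot (c (i.+1%:R / N%:R)) (c t) by rewrite mulr_ge0 // ltW.
  lra.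
(* The first half of the time is used to reach the polygon, the second half
   to reach [q]. *)
pose t' (z : R * R) := clamp01 z.1.
pose mu (z : R * R) := clamp01 (2 * z.2).
pose la (z : R * R) := clamp01 (2 * z.2 - 1).
pose E z := (1 - la z) *: ((1 - mu z) *: c (t' z) + mu z *: p (t' z)) + la z *: q.
have E0 z : E z != 0.
  have := clamp01_itv z.1; rewrite -/(t' z) => t01.
  have [[n pn qn0] dpc] := pE _ t01.
  have [l0|l0] := eqVneq (la z) 0.
    rewrite /E l0 subr0 scale1r scale0r addr0.
    have : 0 < dot ((1 - mu z) *: c (t' z) + mu z *: p (t' z)) (c (t' z)).
      rewrite dot_comb (unit_sphereE _).1 //.
      have /andP[m0' m1] := clamp01_itv (2 * z.2); rewrite -/(mu z) in m0' m1.
      have [->|mn] := eqVneq (mu z) 1; first by rewrite subrr mul0r add0r mul1r.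
      have : 0 <= mu z * dot (p (t' z)) (c (t' z)) by rewrite mulr_ge0 // ltW.
      have : 0 < 1 - mu z by rewrite subr_gt0 lt_neqAle mn.
      lra.
    by apply: contraTneq => ->; rewrite /dot big1 ?ltxx // => i _; rewrite mxE mul0r.
  have mu1 : mu z = 1.
    have z2 : 1 < 2 * z.2.
      rewrite ltNge; apply: contra l0 => h; rewrite /la /clamp01 max_l // ge_min;
        apply/orP; right; lra.
    by rewrite /mu /clamp01 min_l ?max_r //; lra.
  rewrite /E mu1 subrr scale0r add0r scale1r.
  apply: contra qn0 => /eqP/(congr1 (mulmx^~ n)) /=.
  rewrite mulmxDl -!scalemxAl pn scaler0 add0r mul0mx => /eqP.
  by rewrite scaler_eq0 (negPf l0).
have c1 := @continuous_fst R R.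
have c2 := @continuous_snd R R.
have ct' : continuous t' by exact: continuous_clamp.
have cmu : continuous mu.
  by apply: continuous_clamp; apply: continuous_mul => //; exact: continuous_cst.
have cla : continuous la.
  apply: continuous_clamp; apply: continuous_sub; last exact: continuous_cst.
  by apply: continuous_mul => //; exact: continuous_cst.
have cE : continuous E.
  apply: continuous_comb => //.
  - by apply: continuous_sub => //; exact: continuous_cst.
  - apply: continuous_comb => //.
    + by apply: continuous_sub => //; exact: continuous_cst.
    + exact: continuous_after cc ct'.
    + apply: (@continuous_after _ _ _ t' p _ ct'); exact: continuous_polygonal_path.
  - by move=> z; exact: cvg_cst.
have z01 : 0 <= (0 : R) <= 1 by rewrite lexx ler01.
have o01 : 0 <= (1 : R) <= 1 by rewrite lexx ler01.
exists (fun z => normalize (E z)); split.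
- exact: continuous_normalize.
- by move=> z; exact: normalize_sphere.
- move=> t t01; rewrite /E /la /mu /t' /= mulr0.
  have -> : clamp01 (0 - 1 : R) = 0 by rewrite /clamp01 max_l // ge_min sub0r oppr_le0
    ler01 orbT.
  by rewrite !clamp01_id // !subr0 !scale1r !scale0r !addr0 normalize_id.
- move=> u; rewrite /E /t' /= (clamp01_id z01) (clamp01_id o01).
  rewrite {1}/p polygonal_path0 /p polygonal_path1.
  have -> : last (c 0) pts = c 1.
    have -> : last (c 0) pts = nth 0 (c 0 :: pts) N by rewrite -spts (nth_last 0 (c 0 ::
      pts)).
    by rewrite nthc // divff ?gt_eqF.
  by rewrite c01.
- move=> t; rewrite /E /la /= mulr1 (_ : clamp01 (2 - 1) = 1) ?subrr ?scale0r //.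
  by rewrite (_ : 2 - 1 = 1) ?clamp01_id //; lra.
Qed.

End Spheres.

(** * Free homotopies of loops *)

Section FreeHomotopies.
Local Open Scope ring_scope.
Variable R : realType.

Lemma itv01 (t : R) : (t \in `[0, 1]) = (0 <= t <= 1).
Proof. by rewrite in_itv. Qed.

Lemma continuous_pair (X Y Z : topologicalType) (f : X -> Y) (g : X -> Z) :
  continuous f -> continuous g -> continuous (fun x => (f x, g x)).
Proof. by move=> cf cg x; apply: cvg_pair; [exact: cf|exact: cg]. Qed.

(** A contraction that may move the base point. It is easier to find
    than a homotopy relative to the end points, and yields one
    ([free_null_homotopic]). *)
Definition free_contraction (X : topologicalType) (A : set X)
    (c : R -> X) (H : R * R -> X) : Prop :=
  [/\ continuous H, forall z, A (H z),
      forall t, 0 <= t <= 1 -> H (t, 0) = c t,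
      forall u, H (0, u) = H (1, u) & forall t, H (t, 1) = H (0, 1)].

Lemma null_homotopic_free (X : topologicalType) (A : set X) (c : R -> X) :
  null_homotopic A c -> exists H, free_contraction A c H.
Proof.
case=> H [cH AH H0 H1 Hb].
pose sq (z : R * R) := (clamp01 z.1, clamp01 z.2).
have sqP z : ((`[0, 1] `*` `[0, 1])%classic : set (R * R)) (sq z).
  by split; rewrite /= in_itv; exact: clamp01_itv.
have csq : continuous sq.
  by apply: continuous_pair; apply: continuous_clamp;
    [exact: continuous_fst|exact: continuous_snd].
have z01 : 0 <= (0 : R) <= 1 by rewrite lexx ler01.
have o01 : 0 <= (1 : R) <= 1 by rewrite lexx ler01.
exists (fun z => H (sq z)); rewrite /sq; split=> /=.
- exact: (within_comp cH csq sqP).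
- by move=> z; apply: AH; exact: sqP.
- by move=> t t01; rewrite !clamp01_id // H0 // itv01.
- move=> u; rewrite (clamp01_id z01) (clamp01_id o01).
  by have [-> ->] := Hb (clamp01 u) (etrans (itv01 _) (clamp01_itv u)).
- by move=> t; rewrite (clamp01_id z01) (clamp01_id o01) !H1 // itv01 ?clamp01_itv.
Qed.

(** Sweep the square by the paths that run up the left side to height [u],
    cross, and run down the right side. As the top is constant and both sides
    agree, the last of them runs along a path and back, and it retracts to its
    origin. *)
Lemma free_null_homotopic n (A : set 'rV[R]_n) c H :
  free_contraction A c H -> null_homotopic A c.
Proof.
case=> cH AH H0 Hs H1.
pose u1 (z : R * R) := clamp01 (2 * z.2).
pose v (z : R * R) := clamp01 (2 * z.2 - 1).
pose l1 (z : R * R) := clamp01 (Num.min (3 * z.1) (3 * (1 - z.1))).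
pose la (z : R * R) := Num.min (u1 z) (l1 z).
pose th (z : R * R) := clamp01 ((z.1 - u1 z / 3) / (1 - 2 * u1 z / 3)).
(* At time [z.2] <= 1/2 the path is [H (th, la)] and the two other terms cancel;
   from then on [H (th, la)] and the last term cancel. *)
pose F z := H (th z, la z) + (H (0, (1 - v z) * l1 z) - H (0, l1 z)).
have c1 := @continuous_fst R R; have c2 := @continuous_snd R R.
have cc r : continuous (fun _ : R * R => r : R) by exact: continuous_cst.
have cu1 : continuous u1 by apply: continuous_clamp; exact: continuous_mul.
have cv : continuous v by apply: continuous_clamp; apply: continuous_sub => //;
  exact: continuous_mul.
have cl1 : continuous l1.
  apply: continuous_clamp; apply: continuous_minr; apply: continuous_mul => //.
  exact: continuous_sub.
have cla : continuous la by exact: continuous_minr.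
have u1P z := clamp01_itv (2 * z.2) : 0 <= u1 z <= 1.
have den z : 0 < 1 - 2 * u1 z / 3 by have := u1P z; lra.
have cth : continuous th.
  apply: continuous_clamp; apply: continuous_mul.
    by apply: continuous_sub => //; apply: continuous_mul.
  apply: continuous_inv => [z|]; first by rewrite gt_eqF.
  by apply: continuous_sub => //; apply: continuous_mul => //; apply: continuous_mul.
have cF : continuous F.
  apply: continuous_row => j.
  have -> : (fun z => F z 0 j) = (fun z => H (th z, la z) 0 j + (H (0,
    (1 - v z) * l1 z) 0 j - H (0, l1 z) 0 j)).
    by apply/funext => z; rewrite !mxE.
  apply: continuous_add; first apply: (@continuous_coord R _ _ (fun z => H (th z, la z))).
    exact: (@continuous_after _ _ _ (fun z => (th z, la z)) H cH (continuous_pair cth cla)).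
  apply: continuous_sub.
    apply: (@continuous_coord R _ _ (fun z => H (0, (1 - v z) * l1 z))).
    apply: (@continuous_after _ _ _ (fun z => (0, (1 - v z) * l1 z)) H cH);
      apply: continuous_pair => //.
    by apply: continuous_mul => //; apply: continuous_sub.
  apply: (@continuous_coord R _ _ (fun z => H (0, l1 z))).
  exact: (@continuous_after _ _ _ (fun z => (0, l1 z)) H cH (continuous_pair (cc 0) cl1)).
have c0 : c 0 = H (0, 0) by rewrite H0 // lexx ler01.
have F_late z : u1 z = 1 -> F z = H (0, (1 - v z) * l1 z).
  move=> u1z; suff e : H (th z, la z) = H (0, l1 z) by rewrite /F e addrCA subrr addr0.
  have l1P : 0 <= l1 z <= 1 by exact: clamp01_itv.
  have -> : la z = l1 z by rewrite /la u1z min_r //; case/andP: l1P.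
  have [->|l1z] := eqVneq (l1 z) 1; first by rewrite !H1.
  have : Num.min (3 * z.1) (3 * (1 - z.1)) < 1.
    rewrite ltNge; apply: contra l1z => h.
    by rewrite /l1 /clamp01 min_l // max_r // ler01.
  rewrite gt_min /th u1z => /orP[] h.
    rewrite (_ : clamp01 _ = 0) // /clamp01 max_l // ge_min; apply/orP; right.
    rewrite pmulr_lle0 ?invr_gt0; lra.
  rewrite (_ : clamp01 _ = 1) // /clamp01 min_l ?max_r ?ler01 //.
  rewrite ler_pdivlMr; lra.
have v0P z : v z = 0 \/ u1 z = 1.
  have [h|h] := leP (2 * z.2) 1; [left|right].
    by rewrite /v /clamp01 max_l // ge_min; apply/orP; right; lra.
  by rewrite /u1 /clamp01 min_l ?max_r //; lra.
exists F; split.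
- exact: continuous_subspaceT.
- move=> z _; have [vz|/F_late ->] := v0P z; last exact: AH.
  by rewrite /F vz subr0 mul1r subrr addr0; exact: AH.
- move=> t; rewrite itv01 => t01.
  have u10 : u1 (t, 0) = 0 by rewrite /u1 /= mulr0 clamp01_id // lexx ler01.
  have v0 : v (t, 0) = 0.
    by rewrite /v /= mulr0 /clamp01 max_l // ge_min sub0r oppr_le0 ler01 orbT.
  rewrite /F v0 subr0 mul1r subrr addr0 /th /la u10 /= !mul0r subr0 mulr0 mul0r subr0 divr1.
  by rewrite clamp01_id // min_l ?H0 //; case/andP: (clamp01_itv (Num.min (3 * t)
    (3 * (1 - t)))).
- move=> t _; have v1 : v (t, 1) = 1.
    by rewrite /v /= mulr1 clamp01_id //; lra.
  rewrite F_late ?v1 ?subrr ?mul0r //.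
  by rewrite /u1 /= mulr1 /clamp01 min_l ?max_r //; lra.
- move=> u; rewrite itv01 => u01.
  have aux t : l1 (t, u) = 0 -> F (t, u) = H (th (t, u), 0).
    move=> l10; rewrite /F /la l10 mulr0 subrr addr0 min_r //.
    by case/andP: (u1P (t, u)).
  split; rewrite aux.
  + rewrite c0; congr (H (_, _)); have := u1P (0, u); rewrite /th => h.
    rewrite /clamp01 max_l // ge_min; apply/orP; right.
    by rewrite pmulr_lle0 ?invr_gt0 //=; lra.
  + rewrite /l1 /= mulr0 min_l; last by lra.
    by rewrite clamp01_id // lexx ler01.
  + rewrite c0 Hs; congr (H (_, _)); have := u1P (1, u); rewrite /th => h.
    rewrite /clamp01 min_l ?max_r ?ler01 //=.
    by rewrite ler_pdivlMr // mul1r; lra.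
  + rewrite /l1 /= subrr mulr0 min_r; last by lra.
    by rewrite clamp01_id // lexx ler01.
Qed.

End FreeHomotopies.

(** * Facet paths in the realization *)

Section Realizations.
Local Open Scope ring_scope.
Variables (R : realType) (V : finType).
Implicit Types (C : {set {set V}}) (s t k f : {set V}) (g : seq {set V}) (x y :
  'rV[R]_#|V|).

Definition in_simplex f x : Prop := [/\ forall i, 0 <= x 0 i, \sum_i x 0 i = 1
  & forall v, x 0 (enum_rank v) != 0 -> v \in f].

Lemma in_simplexS f f' x : f \subset f' -> in_simplex f x -> in_simplex f' x.
Proof. by move=> /fintype.subsetP ff [x0 x1 xf]; split=> // v /xf /ff. Qed.

Lemma in_simplex_comb f x y (a b : R) : 0 <= a -> 0 <= b -> a + b = 1 ->
  in_simplex f x -> in_simplex f y -> in_simplex f (a *: x + b *: y).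
Proof.
move=> a0 b0 ab [x0 x1 xf] [y0 y1 yf]; split.
- by move=> i; rewrite !mxE addr_ge0 // mulr_ge0.
- under eq_bigr do rewrite !mxE.
  by rewrite big_split -!mulr_sumr x1 y1 !mulr1.
move=> v; rewrite !mxE; have [xv|/xf //] := eqVneq (x 0 (enum_rank v)) 0.
have [yv|/yf //] := eqVneq (y 0 (enum_rank v)) 0.
by rewrite xv yv !mulr0 addr0 eqxx.
Qed.

Lemma barycenter_in_simplex s : s != finset.set0 -> in_simplex s (barycenter R s).
Proof.
move=> s0; split=> [i||v].
- by rewrite mxE; case: ifP => // _; rewrite invr_ge0.
- under eq_bigr do rewrite mxE.
  rewrite -big_mkcond /= (reindex (@enum_rank V)); last first.
    by apply: onW_bij; exact: enum_rank_bij.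
  under eq_bigl do rewrite enum_rankK.
  by rewrite sumr_const -[LHS]mulr_natr mulVf // pnatr_eq0 cards_eq0.
by rewrite mxE enum_rankK; case: ifP => //; rewrite eqxx.
Qed.

Lemma in_simplex_realization C f x : simplicial_complex C -> f \in C ->
  in_simplex f x -> realization C x.
Proof.
move=> [_ sub] fC [x0 x1 xf]; split=> //; apply: sub fC _.
by apply/fintype.subsetP => v; rewrite inE; exact: xf.
Qed.

(** Barycenters of facets have even, those of ridges odd positions in
    [barycenter s :: path_vertices s g]. *)
Definition path_vertices s g : seq 'rV[R]_#|V| :=
  flatten (pairmap (fun t u => [:: barycenter R (t :&: u); barycenter R u]) s g).

Lemma realization_pathE s g :
  realization_path s g = polygonal_path (barycenter R s) (path_vertices s g).
Proof. by []. Qed.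

Lemma size_vertices s g : size (path_vertices s g) = (2 * size g)%N.
Proof. by elim: g s => [|u g IH] s //=; rewrite IH mulnS. Qed.

Lemma nth_vertices_even s g i : (i <= size g)%N ->
  nth 0 (barycenter R s :: path_vertices s g) (2 * i)%N = barycenter R (nth s (s :: g) i).
Proof.
elim: g s i => [|u g IH] s [|i] // ig; rewrite mulnS add2n.
rewrite -[LHS]/(nth 0 (barycenter R u :: path_vertices u g)
  (2 * i)%N) -[nth s _ _]/(nth s (u :: g) i).
by rewrite (IH u i) // (set_nth_default s).
Qed.

Lemma nth_vertices_odd s g i : (i < size g)%N ->
  nth 0 (barycenter R s :: path_vertices s g) (2 * i)%N.+1 =
  barycenter R (nth s (s :: g) i :&: nth s (s :: g) i.+1).
Proof.
elim: g s i => [|u g IH] s [|i] // ig; rewrite mulnS add2n.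
rewrite -[LHS]/(nth 0 (barycenter R u :: path_vertices u g) (2 * i)%N.+1).
rewrite -[nth s _ i.+1]/(nth s (u :: g) i) -[nth s _ i.+2]/(nth s (u :: g) i.+1).
by rewrite (IH u i) // (set_nth_default s) 1?ltnW // (set_nth_default s).
Qed.

(** The empty simplex has no barycenter. *)
Definition proper_path s g : Prop := forall i, (i <= size g)%N ->
  nth s (s :: g) i != finset.set0 /\
  ((i < size g)%N -> nth s (s :: g) i :&: nth s (s :: g) i.+1 != finset.set0).

(** The facet [i] is met around time [i / n], between the barycenters of its
    two ridges on the path. *)
Lemma realization_path_near s g (t : R) i : proper_path s g -> 0 <= t <= 1 ->
  (i <= size g)%N -> `|(size g)%:R * t - i%:R| <= 2^-1 ->
  in_simplex (nth s (s :: g) i) (realization_path s g t).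
Proof.
move=> pr t01 ig; rewrite ler_norml => near.
have [n0|n0] := posnP (size g).
  case: g n0 ig {near} pr => // _; rewrite leqn0 => /eqP-> pr.
  rewrite /realization_path /polygonal_path /= big_ord0 addr0.
  by apply: barycenter_in_simplex; have [] := pr 0%N isT.
set P := realization_path _ _ _.
have sz := size_vertices s g.
have yE : (size (path_vertices s g))%:R * t = 2 * ((size g)%:R * t) by rewrite sz natrM
  mulrA.
have tn : 0 <= (size g)%:R * t <= (size g)%:R.
  by case/andP: t01 => t0 t1; rewrite mulr_ge0 //= ler_piMr.
set y := (size g)%:R * t in near tn yE.
have seg j (u v : {set V}) : (j < size (path_vertices s g))%N -> j%:R <= 2 * y <= j.+1%:R ->
    nth 0 (barycenter R s :: path_vertices s g) j = barycenter R u ->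
    nth 0 (barycenter R s :: path_vertices s g) j.+1 = barycenter R v ->
    u != finset.set0 -> v != finset.set0 -> u \subset nth s (s :: g) i ->
      v \subset nth s (s :: g) i ->
    in_simplex (nth s (s :: g) i) P.
  move=> js jy uE vE u0 v0 us vs.
  rewrite /P realization_pathE (@polygonal_pathE _ _ _ _ _ j) // yE //.
  move: vE => /= ->; rewrite uE; set th := _ - _.
  have -> : barycenter R u + th *: (barycenter R v - barycenter R u) =
      (1 - th) *: barycenter R u + th *: barycenter R v.
    by rewrite scalerBr [(1 - _) *: _]scalerBl scale1r addrA addrAC.
  move: jy; rewrite -natr1 => jy.
  apply: in_simplex_comb; rewrite /th; try lra.
  - exact: in_simplexS us (barycenter_in_simplex u0).
  - exact: in_simplexS vs (barycenter_in_simplex v0).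
have [iy|yi] := leP i%:R y.
  have [ilt|ige] := ltnP i (size g).
    apply: (seg (2 * i)%N (nth s (s :: g) i)
      (nth s (s :: g) i :&: nth s (s :: g) i.+1)) => //.
    - by rewrite sz ltn_pmul2l.
    - by rewrite -natr1 natrM; lra.
    - exact: nth_vertices_even.
    - exact: nth_vertices_odd.
    - by have [] := pr i ig.
    - by have [_] := pr i ig; apply.
    - exact: finset.subsetIl.
  have ei : i = size g by apply/eqP; rewrite eqn_leq ig.
  have yn : y = i%:R by move: tn; rewrite -ei; lra.
  have ip : i = i.-1.+1 by rewrite prednK // ei.
  have lt : (i.-1 < size g)%N by rewrite -ip.
  have E2 : (2 * i = (2 * i.-1).+2)%N by rewrite {1}ip mulnS.
  apply: (seg (2 * i.-1)%N.+1 (nth s (s :: g) i.-1 :&: nth s (s :: g) i)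
    (nth s (s :: g) i)) => //.
  - by rewrite sz -ei E2.
  - rewrite -E2 yn natrM lexx andbT -natrM ler_nat E2 //.
  - by rewrite nth_vertices_odd // -ip.
  - by rewrite -E2 nth_vertices_even.
  - by have [_] := pr i.-1 (ltnW lt); rewrite -ip; apply.
  - by have [] := pr i ig.
  - exact: finset.subsetIr.
have i0 : (0 < i)%N by case: (i) yi tn => //=; lra.
have ip : i = i.-1.+1 by rewrite prednK.
have lt : (i.-1 < size g)%N by rewrite -ip.
have E2 : (2 * i = (2 * i.-1).+2)%N by rewrite {1}ip mulnS.
apply: (seg (2 * i.-1)%N.+1 (nth s (s :: g) i.-1 :&: nth s (s :: g) i)
  (nth s (s :: g) i)) => //.
- by rewrite sz (@leq_trans (2 * i)%N) ?E2 // -E2 leq_mul2l.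
- have : (2 * i)%N%:R = (2 * i.-1)%N.+1%:R + 1 :> R by rewrite E2 -natr1.
  rewrite -E2 natrM => h; lra.
- by rewrite nth_vertices_odd // -ip.
- by rewrite -E2 nth_vertices_even.
- by have [_] := pr i.-1 (ltnW lt); rewrite -ip; apply.
- by have [] := pr i ig.
- exact: finset.subsetIr.
Qed.

Lemma realization_path1 s g : realization_path s g 1 = barycenter R (last s g).
Proof.
rewrite realization_pathE polygonal_path1 (last_nth 0) size_vertices.
by rewrite nth_vertices_even // -last_nth.
Qed.

Lemma continuous_realization_path s g : continuous (realization_path (R := R) s g).
Proof. exact: continuous_polygonal_path. Qed.

Lemma nearest (n : nat) (y : R) : 0 <= y <= n%:R ->
  exists2 i, (i <= n)%N & `|y - i%:R| <= 2^-1.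
Proof.
case: n => [|n] yn; first by exists 0%N;
  rewrite // (@le_anti _ _ y 0) 1?andbC // subr0 normr0 invr_ge0.
have [i iN] := locate (isT : (0 < n.+1)%N) yn; rewrite -natr1 => ih.
have [h|h] := leP y (i%:R + 2^-1).
  by exists i; [exact: ltnW|rewrite ler_norml; lra].
by exists i.+1 => //; rewrite ler_norml -[i.+1%:R]natr1; lra.
Qed.

Lemma realization_path_in C s g (t : R) : simplicial_complex C -> proper_path s g ->
  (forall f, f \in s :: g -> f \in C) -> 0 <= t <= 1 ->
    realization C (realization_path s g t).
Proof.
move=> cC pr gC t01; have tn : 0 <= (size g)%:R * t <= (size g)%:R.
  by case/andP: t01 => t0 t1; rewrite mulr_ge0 //= ler_piMr.
have [i ig near] := nearest tn.
apply: in_simplex_realization (realization_path_near pr t01 ig near) => //.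
by apply: gC; rewrite mem_nth.
Qed.

End Realizations.

(** * Loops that run to a star, around in it, and back *)

Section StarLoops.
Local Open Scope ring_scope.
Variables (R : realType) (V : finType).
Implicit Types (C : {set {set V}}) (s t k f : {set V}) (g l : seq {set V}) (x y :
  'rV[R]_#|V|).

(** If a polygon returns on its initial part then it does so at the same
    speed. *)
Lemma polygonal_path_sym m (x : 'rV[R]_m) (s : seq 'rV[R]_m) (J : nat) (t : R) :
  (J <= size s)%N -> (forall j, (j <= J)%N ->
    nth 0 (x :: s) (size s - j)%N = nth 0 (x :: s) j) ->
  0 <= t -> (size s)%:R * t <= J%:R -> polygonal_path x s (1 - t) = polygonal_path x s t.
Proof.
move=> JN sym t0 tJ; have [s0|s0] := posnP (size s).
  by rewrite /polygonal_path; case: s s0 {JN sym tJ} => //= _; rewrite !big_ord0.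
have N0 : 0 < (size s)%:R :> R by rewrite ltr0n.
have [J0|J0] := posnP J.
  have -> : t = 0.
    apply/eqP; rewrite eq_le t0 andbT -(ler_pM2l N0) mulr0.
    by move: tJ; rewrite J0.
  by rewrite subr0 polygonal_path0 polygonal_path1 (last_nth 0) -[RHS](sym 0%N) // subn0.
have h : 0 <= (size s)%:R * t <= J%:R by rewrite mulr_ge0 // ltW.
have [i iJ ih] := locate J0 h.
have iN : (i < size s)%N := leq_trans iJ JN.
have NE : (size s - i.+1).+1 = (size s - i)%N by rewrite subnSK.
have iE : (size s - i.+1)%N%:R = (size s)%:R - i%:R - 1 :> R.
  by rewrite natrB // -natr1; lra.
have E1 := sym i (ltnW iJ); have E2 := sym i.+1 iJ.
rewrite (polygonal_pathE x iN ih) (@polygonal_pathE _ _ _ _ _ (size s - i.+1)); first last.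
- rewrite iE NE natrB 1?ltnW // mulrBr mulr1; move: ih; rewrite -natr1; lra.
- by rewrite -subn_gt0 subKn // subn_gt0 leq_subr.
rewrite E2 -[nth 0 s (_ - _)]/(nth 0 (x :: s) (size s - i.+1).+1) NE E1.
rewrite iE mulrBr mulr1; set y := (size s)%:R * t.
rewrite [nth 0 (x :: s) i.+1]/=; apply/rowP => j; rewrite !mxE; ring.
Qed.

Section Lasso.
Variables (C : {set {set V}}) (k s0 : {set V}) (g l : seq {set V}).
Let s := last s0 g.
Let w := g ++ l ++ inverse_path s0 g.
Let a := size g.
Let n := size w.
Hypothesis complexC : simplicial_complex C.
Hypothesis k0 : k != finset.set0.
Hypothesis proper_w : proper_path s0 w.
Hypothesis wC : forall f, f \in s0 :: w -> f \in C.
Hypothesis loop_l : last s l = s.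
Hypothesis kl : forall f, f \in s :: l -> k \subset f.

Lemma lasso_size : n = (a + size l + a)%N.
Proof. by rewrite /n !size_cat /inverse_path size_rev size_belast addnA. Qed.

Lemma lasso_mid i : (i <= size l)%N -> nth s0 (s0 :: w) (a + i) = nth s (s :: l) i.
Proof.
have -> : s0 :: w = belast s0 g ++ (s :: l) ++ inverse_path s0 g.
  by rewrite /w -cat_cons lastI -/s cat_rcons.
move=> il; rewrite nth_cat size_belast -/a ltnNge leq_addr /= addKn -cat_cons nth_cat /=
  ltnS il.
by rewrite (set_nth_default s).
Qed.

Lemma lasso_sym i : (i <= a)%N -> nth s0 (s0 :: w) (n - i) = nth s0 (s0 :: w) i.
Proof.
rewrite leq_eqVlt => /orP[/eqP->|ia].
  have E0 := lasso_mid (leq0n (size l)); rewrite addn0 /= in E0.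
  by rewrite lasso_size addnK (lasso_mid (leqnn _)) E0 -[in RHS]loop_l (last_nth s).
have -> : s0 :: w = (belast s0 g ++ (s :: l)) ++ inverse_path s0 g.
  by rewrite /w -cat_cons lastI -/s cat_rcons -catA.
have -> : nth s0 ((belast s0 g ++ s :: l) ++ inverse_path s0 g) i = nth s0 (belast s0 g) i.
  by rewrite -catA nth_cat size_belast ia.
rewrite nth_cat size_cat size_belast /= -/a lasso_size.
rewrite ltnNge (_ : (_ <= _)%N) /=; last by lia.
rewrite /inverse_path nth_rev size_belast -/a; last by lia.
by congr (nth _ _ _); lia.
Qed.

(** First the path along [g] and the way back are shortened simultaneously from
    the first facet, which moves the base point along [g]. What is left is the
    loop in the star of [k], every simplex of which spans a simplex together
    with [k]; it contracts linearly to the barycenter of [k]. *)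
Lemma lasso_null_homotopic :
  null_homotopic (realization C) (realization_path (R := R) s0 w).
Proof.
(* The way along [g] takes time [r], so the time runs from [tau] to [1 - tau],
   where [tau] grows to [r]. *)
apply: (@free_null_homotopic _ _ _ _ (fun z : R * R =>
  let r : R := a%:R / n%:R in
  let tau := clamp01 (2 * z.2) * r in let la := clamp01 (2 * z.2 - 1) in
  (1 - la) *: realization_path s0 w (Num.max tau (Num.min (1 - tau) z.1)) + la *:
    barycenter R k)).
set r : R := a%:R / n%:R.
have an : (a <= n)%N by rewrite lasso_size -addnA leq_addr.
have r0 : 0 <= r by apply: divr_ge0.
have rn : n%:R * r = a%:R.
  have [n0|n0] := posnP n; last by rewrite /r mulrC divfK // pnatr_eq0 -lt0n.
  by rewrite n0 mul0r; move: an; rewrite n0 leqn0 => /eqP->.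
have r2 : r <= 2^-1.
  have [n0|n0] := posnP n; first by rewrite /r n0 invr0 mulr0 invr_ge0.
  rewrite /r ler_pdivrMr ?ltr0n // lasso_size !natrD.
  have : 0 <= (size l)%:R :> R by []. lra.
pose tau (z : R * R) := clamp01 (2 * z.2) * r.
pose la (z : R * R) := clamp01 (2 * z.2 - 1).
pose ct (z : R * R) := Num.max (tau z) (Num.min (1 - tau z) z.1).
have tauP z : 0 <= tau z <= r.
  have /andP[h0 h1] := clamp01_itv (2 * z.2); rewrite /tau.
  by rewrite mulr_ge0 //= ler_piMl.
have ctP z : tau z <= ct z <= 1 - tau z.
  have := tauP z; rewrite /ct le_max lexx /= ge_max ge_min lexx /= andbT; lra.
have la0P z : la z = 0 \/ tau z = r.
  have [h|h] := leP (2 * z.2) 1; [left|right].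
    by rewrite /la /clamp01 max_l // ge_min; apply/orP; right; lra.
  by rewrite /tau /clamp01 min_l ?max_r ?mul1r //; lra.
have c1 := @continuous_fst R R; have c2 := @continuous_snd R R.
have cc (e : R) : continuous (fun _ : R * R => e) by exact: continuous_cst.
have ctau : continuous tau by apply: continuous_mul => //; apply: continuous_clamp;
  exact: continuous_mul.
have cct : continuous ct.
  by apply: continuous_maxr => //; apply: continuous_minr => //; exact: continuous_sub.
have cla : continuous la by apply: continuous_clamp; apply: continuous_sub => //;
  exact: continuous_mul.
have Psym u : realization_path s0 w (tau (1, u)) = realization_path s0 w (1 - tau (1, u)).
  have /andP[h0 h1] := tauP (1, u).
  have sz := size_vertices R s0 w.
  rewrite !realization_pathE; apply/esym; apply: (@polygonal_path_sym _ _ _ (2 * a)%N) =>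
    //.
  - by rewrite sz leq_mul2l.
  - move=> j ja; rewrite sz -/n.
    have [odd_j|even_j] := boolP (odd j); last first.
      have jE : j = (2 * j./2)%N by rewrite mul2n -[LHS]odd_double_half (negPf even_j).
      have ja2 : (j./2 <= a)%N by rewrite -(leq_pmul2l (ltn0Sn 1)) -jE.
      rewrite jE -mulnBr !nth_vertices_even; first by rewrite lasso_sym.
        exact: leq_trans an.
      by rewrite -/n leq_subr.
    have jE : j = (2 * j./2).+1%N by rewrite mul2n -[LHS]odd_double_half odd_j.
    have ja2 : (j./2 < a)%N by rewrite -(ltn_pmul2l (ltn0Sn 1)) -jE.
    have jn : (j./2 < n)%N := leq_trans ja2 an.
    have nE : (2 * n - j = (2 * (n - j./2.+1)).+1)%N by rewrite {1}jE; lia.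
    rewrite nE [in RHS]jE !nth_vertices_odd //; last by rewrite -/n; lia.
    by rewrite subnSK // lasso_sym // lasso_sym 1?ltnW // finset.setIC.
  - rewrite sz -/n !natrM -mulrA ler_pM2l // -rn; exact: ler_wpM2l.
split.
- apply: continuous_comb => //.
  + exact: continuous_sub.
  + exact: (@continuous_after _ _ _ ct _ (@continuous_realization_path R V s0 w) cct).
  + by move=> z; exact: cvg_cst.
- move=> z; rewrite -/(tau z) -/(la z) -/(ct z) /=.
  have ct01 : 0 <= ct z <= 1 by have := ctP z; have := tauP z; lra.
  have [->|taur] := la0P z.
    rewrite subr0 scale1r scale0r addr0; exact: realization_path_in.
  have ctr := ctP z; rewrite taur in ctr.
  have h : 0 <= n%:R * ct z - a%:R <= (size l)%:R.
    have n0 : 0 <= n%:R :> R by [].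
    have /andP[q1 q2] := ctr.
    have := ler_wpM2l n0 q1; have := ler_wpM2l n0 q2.
    rewrite mulrBr mulr1 rn => {}q2 {}q1;
      have nE : n%:R = a%:R + (size l)%:R + a%:R :> R by rewrite lasso_size !natrD.
    lra.
  have [i il near] := nearest h.
  have ain : (a + i <= n)%N by rewrite lasso_size; lia.
  have := @realization_path_near R V s0 w (ct z) (a + i)%N proper_w ct01 ain.
  rewrite -/n natrD opprD addrA => /(_ near); rewrite lasso_mid // => inS.
  have fl : nth s (s :: l) i \in s :: l by rewrite mem_nth.
  have fC : nth s (s :: l) i \in C.
    by apply: wC; rewrite -lasso_mid // mem_nth.
  have /andP[l0 l1] := clamp01_itv (2 * z.2 - 1); rewrite -/(la z) in l0 l1.
  apply: (in_simplex_realization complexC fC); apply: in_simplex_comb => //;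
    first by rewrite subr_ge0.
    by rewrite subrK.
  exact: in_simplexS (kl fl) (barycenter_in_simplex R k0).
- move=> t t01; rewrite /= mulr0 sub0r.
  have -> : clamp01 (0 : R) = 0 by rewrite clamp01_id // lexx ler01.
  have -> : clamp01 (-1 : R) = 0 by rewrite /clamp01 max_l // ge_min oppr_le0 ler01 orbT.
  by rewrite mul0r !subr0 scale1r scale0r addr0 min_r ?max_r //; case/andP: t01.
- move=> u; rewrite /= -/(tau (1, u)); have := tauP (1, u) => t1.
  have e0 : Num.max (tau (1, u)) (Num.min (1 - tau (1, u)) 0) = tau (1, u).
    by rewrite min_r ?max_l //; lra.
  have e1 : Num.max (tau (1, u)) (Num.min (1 - tau (1, u)) 1) = 1 - tau (1, u).
    by rewrite min_l ?max_r //; lra.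
  by rewrite e0 e1 Psym.
- move=> t /=; rewrite mulr1; have -> : 2 - 1 = 1 :> R by lra.
  by rewrite clamp01_id ?lexx ?ler01 // subrr !scale0r.
Qed.

End Lasso.
End StarLoops.

(** * From homotopies to grids of facets *)

Section Discretization.
Local Open Scope ring_scope.
Variables (R : realType) (V : finType) (C : {set {set V}}).
Hypothesis complexC : simplicial_complex C.
Implicit Types (s t k f u : {set V}) (g l : seq {set V}) (x y : 'rV[R]_#|V|).

Definition supp x : {set V} := [set v | x 0 (enum_rank v) != 0]%SET.

Lemma in_simplex_supp f x : in_simplex f x -> supp x \subset f.
Proof. by case=> _ _ xf; apply/fintype.subsetP => v; rewrite inE; exact: xf. Qed.

(** A Lebesgue number for the cover by open vertex stars. Some barycentric
    coordinate is at least [1 / #|V|], and it remains positive where the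
    coordinates change by less than that. *)
Lemma fine_grid (L : {set {set V}}) (H : R * R -> 'rV[R]_#|V|) :
  continuous H -> (forall z, realization L (H z)) ->
  exists2 K0 : nat, (0 < K0)%N & forall x : R * R, 0 <= x.1 <= 1 -> 0 <= x.2 <= 1 ->
    exists v, forall y : R * R, `|x.1 - y.1| <= K0%:R^-1 -> `|x.2 - y.2| <= K0%:R^-1 ->
      v \in supp (H y).
Proof.
move=> cH HL.
have V0 : (0 < #|V|)%N.
  have [_ + _] := HL (0, 0); case: #|V| (H (0, 0)) => // h; rewrite big_ord0.
  by move/esym/eqP; rewrite oner_eq0.
have e0 : 0 < (#|V|%:R : R)^-1 by rewrite invr_gt0 ltr0n.
have [d d0 unif] := square_unif cH e0.
have dN := truncnS_gt d^-1; set N := (Num.truncn d^-1).+1 in dN.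
have Nd : N%:R^-1 < d by rewrite -[d]invrK ltf_pV2 ?posrE ?invr_gt0 // ltr0n.
exists N => // x x1 x2.
have [i Hi] : exists i, #|V|%:R^-1 <= H x 0 i.
  apply: contrapT => /forallNP no; have [_ sum1 _] := HL x.
  have : \sum_i H x 0 i < \sum_(i < #|V|) #|V|%:R^-1.
    apply: ltr_sum; first by apply/hasP; exists (Ordinal V0); rewrite // mem_index_enum.
    by move=> i _; rewrite ltNge; apply/negP; exact: no.
  by rewrite sum1 sumr_const card_ord -[_ *+ _]mulr_natr mulVf ?ltxx // pnatr_eq0 -lt0n.
exists (enum_val i) => y y1 y2; rewrite inE enum_valK.
have := unif x y x1 x2 (le_lt_trans y1 Nd) (le_lt_trans y2 Nd) i.
rewrite ltr_norml => h; rewrite gt_eqF //; lra.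
Qed.

(** Dividing each of the [n] steps of a facet path into [2 * M] parts, time
    [i / (2 * n * M)] belongs to the facet whose index is [i / (2 * M)] rounded
    to the nearest integer. *)
Lemma nearest_index (n M i : nat) : (0 < n)%N -> (0 < M)%N -> (i <= 2 * n * M)%N ->
  [/\ ((i + M) %/ (2 * M) <= n)%N,
     ((i.+1 + M) %/ (2 * M) = (i + M) %/ (2 * M) \/ (i.+1 + M) %/ (2 * M) = ((i + M) %/
       (2 * M)).+1)%N
   & `|n%:R * (i%:R / (2 * n * M)%N%:R) - ((i + M) %/ (2 * M))%N%:R| <= 2^-1 :> R].
Proof.
move=> n0 M0 iK.
have M2 : (0 < 2 * M)%N by rewrite muln_gt0.
have := divn_eq (i + M) (2 * M); have := ltn_pmod (i + M) M2.
set a := ((i + M) %/ _)%N; set r := ((i + M) %% _)%N => r2 e.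
have aE : (a * (2 * M) <= 2 * n * M + M)%N by rewrite (@leq_trans (i + M)) // ?leq_add2r
  // e leq_addr.
split.
- rewrite -ltnS -(ltn_pmul2r M2) (leq_ltn_trans aE) // mulSn; nia.
- rewrite addSn e -addnS divnMDl //.
  have [lt|] := ltnP r.+1 (2 * M); first by left; rewrite divn_small ?addn0.
  move=> ge; right; have -> : r.+1 = (2 * M)%N by apply/eqP; rewrite eqn_leq ge r2.
  by rewrite divnn M2 addn1.
have n0' : 0 < n%:R :> R by rewrite ltr0n.
have M0' : 0 < M%:R :> R by rewrite ltr0n.
have -> : n%:R * (i%:R / (2 * n * M)%N%:R) = i%:R / (2 * M%:R) :> R.
  by rewrite !natrM; field; rewrite !gt_eqF.
have iE : i%:R = a%:R * (2 * M%:R) + r%:R - M%:R :> R.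
  by rewrite -natrM -natrM -natrD -e natrD addrK.
have -> : i%:R / (2 * M%:R) - a%:R = (r%:R - M%:R) / (2 * M%:R) :> R.
  by rewrite iE; field; rewrite gt_eqF.
have rM : r%:R <= 2 * M%:R :> R by rewrite -natrM ler_nat ltnW.
have r0 : 0 <= r%:R :> R by [].
rewrite normrM [X in _ * X]gtr0_norm ?invr_gt0 ?mulr_gt0 // ler_pdivrMr ?mulr_gt0 //.
by rewrite mulrA mulVf ?mul1r ?pnatr_eq0 // ler_norml; lra.
Qed.

Lemma link_facet k x : realization (link C k) x ->
  exists f, [/\ facet C f, k \subset f & supp x \subset f].
Proof.
case=> _ _; rewrite mem_link // => /andP[_ /face_facet[f fC]].
by rewrite finset.subUset => /andP[xf kf]; exists f.
Qed.

Lemma supp_notin k x v : realization (link C k) x -> v \in supp x -> v \notin k.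
Proof. by case=> _ _; rewrite mem_link // => /andP[dis _] vx; rewrite (disjointFr dis). Qed.

Section Link.
Variable k : {set V}.
Hypothesis conn : forall u, u \in C -> k \proper u -> connected_star C u.

Lemma common_vertex_walk v f f' : v \notin k -> facet C f -> facet C f' ->
  k \subset f -> k \subset f' -> v \in f -> v \in f' -> exists p, walk C k f f' p.
Proof.
move=> vk fC fC' kf kf' vf vf'.
have sub (h : {set V}) : k \subset h -> v \in h -> v |: k \subset h by move=> kh vh;
  rewrite finset.subUset finset.sub1set vh.
have vC : v |: k \in C by apply: (face_sub complexC (facet_in fC)); exact: sub.
have kv : k \proper v |: k.
  by rewrite properE finset.subsetUr /=; apply/fintype.subsetPn; exists v;
    rewrite ?inE ?eqxx.
have [p w] := conn vC kv fC fC' (sub _ kf vf) (sub _ kf' vf').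
by exists p; apply: walkS w; exact: finset.subsetUr.
Qed.

(** Consecutive points of a fine subdivision of the path lie in a common open
    vertex star of the link, and facets chosen at them are connected in the
    star of a face larger than [k]. *)
Lemma connected_star_of_path (c : R -> 'rV[R]_#|V|) s t :
  continuous c -> (forall r, realization (link C k) (c r)) ->
  facet C s -> facet C t -> k \subset s -> k \subset t ->
  supp (c 0) \subset s -> supp (c 1) \subset t -> exists p, walk C k s t p.
Proof.
move=> cc cL sC tC ks kt c0 c1.
have [N N0 fine] := fine_grid (continuous_after cc (@continuous_fst R R)) (fun z => cL z.1).
have N0' : 0 < N%:R :> R by rewrite ltr0n.
suff H m : (m <= N)%N -> forall f, facet C f -> k \subset f ->
  supp (c (m%:R / N%:R)) \subset f ->
    exists p, walk C k s f p.
  by apply: (H N) => //; rewrite divff ?gt_eqF.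
elim: m => [_|m IH mN] f fC kf cf.
  rewrite mul0r in cf.
  have z01 : 0 <= (0 : R) <= 1 by rewrite lexx ler01.
  have [v Hv] := fine (0, 0) z01 z01.
  have v0 : v \in supp (c 0) by apply: (Hv (0, 0)); rewrite subrr normr0 invr_ge0.
  apply: (@common_vertex_walk v) => //; first exact: supp_notin (cL 0) v0.
    exact: (fintype.subsetP c0).
  exact: (fintype.subsetP cf).
have [f' [fC' kf' cf']] := link_facet (cL (m%:R / N%:R)).
have [p wp] := IH (ltnW mN) f' fC' kf' cf'.
have m01 : 0 <= (m%:R / N%:R : R) <= 1.
  apply/andP; split; first by apply: divr_ge0; rewrite ler0n.
  by rewrite ler_pdivrMr // mul1r ler_nat ltnW.
have [|v Hv] := fine (m%:R / N%:R, 0) m01; first by rewrite lexx ler01.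
have v1 : v \in supp (c (m%:R / N%:R)) by apply: (Hv (m%:R / N%:R, 0));
  rewrite subrr normr0 invr_ge0.
have v2 : v \in supp (c (m.+1%:R / N%:R)).
  apply: (Hv (m.+1%:R / N%:R, 0)) => /=; last by rewrite subrr normr0 invr_ge0.
  by rewrite -mulrBl -natr1 opprD addNKr mulN1r normrN ger0_norm ?invr_ge0 // ler0n.
have [q wq] := common_vertex_walk (supp_notin (cL _) v1) fC' fC kf' kf
  (fintype.subsetP cf' _ v1) (fintype.subsetP cf _ v2).
by exists (p * q)%g; exact: walkM wp wq.
Qed.

Section GridLoop.
Variables (s0 : {set V}) (N : {group {perm V}}).
Hypothesis triv : forall v, v \notin k -> v |: k \in C -> trivial_star C s0 N (v |: k).
Variables (t : {set V}) (l : seq {set V}) (P : R -> 'rV[R]_#|V|) (H : R * R -> 'rV[R]_#|V|).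
Hypothesis path_l : facet_path (star C k) t l.
Hypothesis loop_l : last t l = t.
Hypothesis contr : free_contraction (realization (link C k)) P H.
Hypothesis near_P : forall (x : R) i, 0 <= x <= 1 -> (i <= size l)%N ->
  `|(size l)%:R * x - i%:R| <= 2^-1 -> supp (P x) \subset nth t (t :: l) i.

Let n := size l.
Let a M i := ((i + M) %/ (2 * M))%N.
Let face i := nth t (t :: l) i.

Lemma face_facet_star i : (i <= n)%N -> facet C (face i) /\ k \subset face i.
Proof. by move=> iN; case/facet_path_starP: path_l => H' _; apply: H'; rewrite mem_nth. Qed.

Lemma row_step M i : (0 < n)%N -> (0 < M)%N -> (i < 2 * n * M)%N -> a M i.+1 = a M i \/
  a M i.+1 = (a M i).+1 /\ adjacent_facets (face (a M i)) (face (a M i.+1)).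
Proof.
move=> n0 M0 iK; have [_ [e|e] _] := nearest_index n0 M0 (ltnW iK); [by left|right;
  split=> //].
have [le _ _] := nearest_index n0 M0 iK.
case/facet_path_starP: path_l => _ /(pathP t) adj.
by rewrite /a e; apply: adj; rewrite -e.
Qed.

Definition top_step M i : {perm V} :=
  if a M i.+1 == a M i then 1%g else perspectivity (face (a M i)) (face (a M i.+1)).

Lemma top_row M m : (0 < n)%N -> (0 < M)%N -> (m <= 2 * n * M)%N ->
  (\prod_(i < m) top_step M i)%g = path_projectivity t (take (a M m) l).
Proof.
move=> n0 M0; elim: m => [_|m IH mK].
  rewrite big_ord0 /a add0n divn_small ?take0 ?path_projectivity_nil //.
  by rewrite -[X in (X < _)%N]mul1n ltn_pmul2r.
rewrite big_ord_recr /= IH 1?ltnW // /top_step.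
have [e|[e adj]] := row_step n0 M0 mK; first by rewrite e eqxx mulg1.
have [le _ _] := nearest_index n0 M0 mK.
have lt : (a M m < size l)%N by rewrite -/n -e.
rewrite e (gtn_eqF (ltnSn _)) (take_nth t) // -cats1 path_projectivity_cat.
rewrite path_projectivity_cons path_projectivity_nil mulg1; congr (_ * perspectivity _ _)%g.
have sz : size (take (a M m) l) = a M m by rewrite size_take lt.
rewrite (last_nth t) sz /face; case: (a M m) lt sz => // b lt sz /=.
by rewrite nth_take.
Qed.

Let some_walk u s s' : {perm V} := xget 1%g [set p | walk C u s s' p]%classic.

Lemma some_walkP u s s' : connected_star C u -> facet C s -> facet C s' ->
  u \subset s -> u \subset s' -> walk C u s s' (some_walk u s s').
Proof. by move=> cu sC sC' us us'; have [p w] := cu s s' sC sC' us us';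
  exact: (xgetPex 1%g (ex_intro _ p w)). Qed.

Let facet_above u : {set V} := odflt t [pick f | facet C f && (u :|: k \subset f)].

Lemma facet_aboveP x : realization (link C k) x ->
  [/\ facet C (facet_above (supp x)),
    k \subset facet_above (supp x) & supp x \subset facet_above (supp x)].
Proof.
case/link_facet => f [fC kf xf]; rewrite /facet_above.
case: pickP => [f' /andP[f'C]|/(_ f)]; last by rewrite fC finset.subUset xf kf.
by rewrite finset.subUset => /andP[xf' kf'] /=.
Qed.

(** A contraction in the link of [k] is cut into a grid as in [grid_trivial].
    The first row consists of the facets of the loop itself. *)
Lemma contraction_good : good C s0 N t (path_projectivity t l).
Proof.
have tC : facet C t /\ k \subset t by apply: (face_facet_star (i := 0)).
have [n0|n0] := posnP n.
  rewrite (size0nil n0) path_projectivity_nil; apply: good1 => [|x _];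
    last by rewrite perm1.
  by apply: walk1; [case: tC|exact: finset.sub0set].
case: contr => cH HL H0 Hs H1.
have [M M0 fine] := fine_grid cH HL.
pose K := (2 * n * M)%N; have K0 : (0 < K)%N by rewrite !muln_gt0 n0.
have K0' : 0 < K%:R :> R by rewrite ltr0n.
have M0' : 0 < M%:R :> R by rewrite ltr0n.
have KM : K%:R^-1 <= M%:R^-1 :> R.
  by rewrite lef_pV2 ?posrE // ler_nat leq_pmull // muln_gt0.
pose z i j : R * R := (i%:R / K%:R, j%:R / K%:R).
have z01 i : (i <= K)%N -> 0 <= (i%:R / K%:R : R) <= 1.
  move=> iK; apply/andP; split; first by apply: divr_ge0; rewrite ler0n.
  by rewrite ler_pdivrMr // mul1r ler_nat.
have cells (ij : nat * nat) : exists v, (ij.1 <= K)%N -> (ij.2 <= K)%N ->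
    forall y : R * R, `|(z ij.1 ij.2).1 - y.1| <= M%:R^-1 ->
      `|(z ij.1 ij.2).2 - y.2| <= M%:R^-1 ->
    v \in supp (H y).
  case: ij => i j /=.
  have z0 : 0 <= (0 : R) <= 1 by rewrite lexx ler01.
  have [v0 _] := fine (0, 0) z0 z0.
  have [iK|iK] := leqP i K; last by exists v0.
  have [jK|jK] := leqP j K; last by exists v0.
  by have [v Hv] := fine (z i j) (z01 i iK) (z01 j jK); exists v.
have [cell cellP] := choice cells.
have dist (i i' : nat) : (i <= i' <= i.+1)%N ->
  `|i%:R / K%:R - i'%:R / K%:R| <= M%:R^-1 :> R.
  rewrite leq_eqVlt => /andP[/orP[/eqP<- _|lt le]]; first by rewrite subrr normr0 invr_ge0.
  have -> : i' = i.+1 by apply/eqP; rewrite eqn_leq le.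
  by rewrite -mulrBl -natr1 opprD addNKr mulN1r normrN ger0_norm // invr_ge0.
have corner i j i' j' : (i < K)%N -> (j < K)%N -> (i <= i' <= i.+1)%N ->
  (j <= j' <= j.+1)%N ->
    cell (i, j) \in supp (H (z i' j')).
  by move=> iK jK ii jj; apply: (cellP (i, j) (ltnW iK) (ltnW jK)); exact: dist.
pose F i j := if j == 0%N then face (a M i) else facet_above (supp (H (z i j))).
have aP i : (i <= K)%N -> (a M i <= n)%N by move=> iK; have [] := nearest_index n0 M0 iK.
have FP i j : (i <= K)%N -> [/\ facet C (F i j),
  k \subset F i j & supp (H (z i j)) \subset F i j].
  move=> iK; rewrite /F; case: eqP => [->|_]; last exact: facet_aboveP.
  have [fC kf] := face_facet_star (aP i iK); split=> //.
  rewrite /z mul0r H0 ?z01 //; apply: near_P => //; [exact: z01|exact: aP|].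
  by have [] := nearest_index n0 M0 iK.
(* The cells left and right of a vertical edge; indices are cyclic, for the
   edges on the left and right sides of the square must get the same paths. *)
pose left_cell i j := cell (if i == 0%N then K.-1 else i.-1, j).
pose right_cell i j := cell (if i == K then 0%N else i, j).
(* A path joining the ends of an edge stays in the stars of the cells on both
   sides of it, so that it can be used for both. *)
pose edge i j := left_cell i j |: (right_cell i j |: k).
pose h i j := if j == 0%N then top_step M i else if j == K then 1%g else
  some_walk (cell (i, j.-1) |: (cell (i, j) |: k)) (F i j) (F i.+1 j).
pose v i j := some_walk (edge i j) (F i j) (F i j.+1).
have in_F (q : V) i j : (i <= K)%N -> q \in supp (H (z i j)) -> q \in F i j.
  by move=> iK qs; have [_ _ /fintype.subsetP] := FP i j iK; apply.
have HK j : H (z K j) = H (z 0%N j) by rewrite /z divff ?gt_eqF // mul0r Hs.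
have aK : a M K = n.
  by rewrite /a /K -mulnA mulnCA divnMDl ?muln_gt0 ?M0 // divn_small ?addn0 // -[X in (X
    < _)%N]mul1n ltn_pmul2r.
have a0 : a M 0%N = 0%N by rewrite /a add0n divn_small // -[X in (X < _)%N]mul1n ltn_pmul2r.
have facet0 : face 0%N = t by [].
have facetn : face n = t by rewrite /face /n -last_nth.
have FK j : F K j = F 0%N j by rewrite /F HK aK a0 facetn.
have edgeP i j (q : V) : (i <= K)%N -> (j < K)%N -> q \in [:: left_cell i j;
  right_cell i j] ->
    q \in supp (H (z i j)) /\ q \in supp (H (z i j.+1)).
  move=> iK jK; rewrite in_cons mem_seq1 => /orP[] /eqP->; rewrite /left_cell /right_cell.
    have [->|i0] := eqVneq i 0%N.
      by rewrite -!HK /= ?eqxx; split; apply: corner;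
        rewrite ?prednK ?leqnn ?leq_pred ?leqnSn.
    by split; apply: corner; rewrite ?prednK ?lt0n ?leqnn ?leq_pred ?leqnSn //;
      apply: leq_ltn_trans iK; rewrite ?ltn_predL ?lt0n.
  have [->|iK'] := eqVneq i K.
    by rewrite !HK ?eqxx; split; apply: corner; rewrite ?leqnn ?leqnSn.
  by split; apply: corner; rewrite ?leqnn ?leqnSn // ltn_neqAle iK'.
have notin (q : V) i j : q \in supp (H (z i j)) -> q \notin k by exact: supp_notin.
have joint (q1 q2 : V) f f' : q1 \notin k -> facet C f -> facet C f' -> k \subset f ->
  k \subset f' ->
    q1 \in f -> q2 \in f -> q1 \in f' -> q2 \in f' ->
    walk C (q1 |: (q2 |: k)) f f' (some_walk (q1 |: (q2 |: k)) f f').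
  move=> qk fC fC' kf kf' q1f q2f q1f' q2f'.
  have sub (e : {set V}) : k \subset e -> q1 \in e -> q2 \in e -> q1 |: (q2 |: k) \subset e.
    by move=> ke q1e q2e; rewrite !finset.subUset !finset.sub1set q1e q2e.
  apply: some_walkP => //; try exact: sub.
  apply: conn; first by apply: (face_sub complexC (facet_in fC)); exact: sub.
  rewrite properE !finset.subsetU ?subxx ?orbT //=.
  by apply/fintype.subsetPn; exists q1; rewrite // !inE eqxx.
have cell_notin i j : (i < K)%N -> (j < K)%N -> cell (i, j) \notin k.
  by move=> iK jK; apply: (notin _ i j); apply: corner; rewrite ?leqnn ?leqnSn.
have cell_F i j i' j' : (i < K)%N -> (j < K)%N -> (i <= i' <= i.+1)%N ->
  (j <= j' <= j.+1)%N ->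
    cell (i, j) \in F i' j'.
  move=> iK jK ii jj; apply: in_F; last exact: corner.
  by case/andP: ii => _ /leq_trans; apply.
have vP i j : (i <= K)%N -> (j < K)%N -> walk C (edge i j) (F i j) (F i j.+1) (v i j).
  move=> iK jK; have [fC kf _] := FP i j iK; have [fC' kf' _] := FP i j.+1 iK.
  have [l1 l2] := edgeP i j _ iK jK (mem_head (left_cell i j) [:: right_cell i j]).
  have [r1 r2] := edgeP i j _ iK jK (mem_last (left_cell i j) [:: right_cell i j]).
  by apply: joint => //; [exact: notin l1| | | |]; exact: in_F.
have hP i j j' : (i < K)%N -> (j < K)%N -> (j <= j' <= j.+1)%N ->
    walk C (cell (i, j) |: k) (F i j') (F i.+1 j') (h i j').
  move=> iK jK jj.
  have [fC kf _] := FP i j' (ltnW iK); have [fC' kf' _] := FP i.+1 j' iK.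
  have cf : cell (i, j) \in F i j' by apply: cell_F; rewrite ?leqnn ?leqnSn.
  have cf' : cell (i, j) \in F i.+1 j' by apply: cell_F; rewrite ?leqnn ?leqnSn.
  have sub f : k \subset f -> cell (i, j) \in f -> cell (i, j) |: k \subset f.
    by move=> kf0 cf0; rewrite finset.subUset finset.sub1set cf0.
  rewrite /h; have [j0|j0] := eqVneq j' 0%N.
    rewrite j0 in fC kf fC' kf' cf cf' *; rewrite /F /= in fC kf fC' kf' cf cf' *.
    rewrite /top_step; have [e|[e adj]] := row_step n0 M0 iK.
      by rewrite e eqxx; apply: walk1 => //; exact: sub.
    have -> : (a M i.+1 == a M i) = false by rewrite e gtn_eqF.
    by apply: walk_step => //; exact: sub.
  have [jK'|jK'] := eqVneq j' K.
    have e i' : H (z i' j') = H (0, 1) by rewrite /z jK' divff ?gt_eqF // H1.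
    have <- : F i j' = F i.+1 j' by rewrite /F (negPf j0) !e.
    by apply: walk1 => //; exact: sub.
  have jj' : (j' < K)%N.
    by rewrite ltn_neqAle jK'; case/andP: jj => _ /leq_trans; apply.
  have pj : (j'.-1 < K)%N by apply: leq_ltn_trans jj'; exact: leq_pred.
  apply: (@walkS _ _ _ (cell (i, j'.-1) |: (cell (i, j') |: k))).
    rewrite finset.subUset finset.sub1set !inE finset.setUA finset.subsetUr andbT.
    have [<-|jn] := eqVneq j j'; first by rewrite eqxx orbT.
    suff -> : j'.-1 = j by rewrite eqxx.
    have /andP[j1 j2] := jj; have lt : (j < j')%N by rewrite ltn_neqAle jn.
    by apply/eqP; move: j2 lt; clear -j0; case: j' j0 => // b _;
      rewrite !ltnS /= eqn_leq => -> ->.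
  have jp : (j'.-1 <= j' <= j'.-1.+1)%N by rewrite prednK ?lt0n // leq_pred leqnn.
  apply: joint => //; first exact: cell_notin.
  - by apply: cell_F; rewrite ?jp // leqnn leqnSn.
  - by apply: cell_F; rewrite ?leqnn ?leqnSn.
  - by apply: cell_F; rewrite ?jp // leqnn leqnSn.
  - by apply: cell_F; rewrite ?leqnn ?leqnSn.
have := @grid_trivial V C s0 N K K F (fun i j => cell (i, j) |: k) h v K0.
have -> : (\prod_(i < K) h i 0%N)%g = path_projectivity t l.
  by rewrite /h /= top_row // aK take_size.
have -> : F 0%N 0%N = t by rewrite /F /= a0.
move=> gt; apply: eqv_good; apply: gt => //; last by case: tC.
- move=> i j iK jK; apply: triv; first exact: cell_notin.
  have [fC kf _] := FP i j (ltnW iK); apply: (face_sub complexC (facet_in fC)).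
  by rewrite finset.subUset finset.sub1set kf cell_F ?leqnn ?leqnSn.
- move=> i j iK jK; split.
  + by apply: hP => //; rewrite leqnn leqnSn.
  + by apply: hP => //; rewrite leqnn leqnSn.
  + apply: walkS (vP i j (ltnW iK) jK).
    by rewrite /edge /right_cell (ltn_eqF iK) finset.subsetUr.
  + apply: walkS (vP i.+1 j iK jK).
    rewrite /edge /left_cell /=; apply: finset.setUS; exact: finset.subsetUr.
- move=> j _; have el : left_cell K j = left_cell 0%N j by rewrite /left_cell (gtn_eqF
    K0) eqxx.
  have er : right_cell K j = right_cell 0%N j by rewrite /right_cell eqxx (ltn_eqF K0).
  by rewrite /v /edge el er !FK.
- by move=> i iK; rewrite /h (gtn_eqF K0) eqxx.
Qed.

End GridLoop.
End Link.
End Discretization.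

(** * Combinatorial manifolds *)

Lemma codim_lt (m a b n : nat) : (n - a < m.+1 -> a < b -> b <= n -> n - b < m)%N.
Proof. lia. Qed.

Section Manifolds.
Local Open Scope ring_scope.
Variables (R : realType) (V : finType) (d : nat) (C : {set {set V}}).
Hypothesis manC : combinatorial_manifold R d C.
Implicit Types (s t k f u : {set V}) (g l : seq {set V}) (x y : 'rV[R]_#|V|).

Lemma manifold_complex : simplicial_complex C. Proof. by case: manC. Qed.
Lemma manifold_size : complex_size C = d.+1. Proof. by case: manC. Qed.
Lemma manifold_dim : (1 <= d)%N. Proof. by case: manC. Qed.
Let complexC := manifold_complex.

Lemma face_card s : s \in C -> (#|s| <= d.+1)%N.
Proof. by move=> sC; rewrite -manifold_size; apply: (leq_bigmax_cond (F := fun s :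
  {set V} => #|s|)). Qed.

(** Pureness: the link of a facet is the complex of the empty simplex alone,
    which is the sphere of dimension -1. *)
Lemma facet_card f : facet C f -> #|f| = d.+1.
Proof.
move=> fC; have fin := facet_in fC.
have linkf : link C f = [set finset.set0]%SET.
  apply/finset.setP => t; rewrite mem_link // inE; apply/andP/eqP => [[dis tf]|->];
    last first.
    by rewrite finset.set0U; split=> //; rewrite -finset.setI_eq0 finset.set0I.
  have e : t :|: f = f by case/maxsetP: fC => _ max; apply: max tf (finset.subsetUr _ _).
  apply/eqP; rewrite -finset.subset0; apply/fintype.subsetP => v vt.
  have vf : v \in f by rewrite -e inE vt.
  by move: (disjointFr dis vt); rewrite vf.
have f0 : f != finset.set0.
  apply/eqP => f0; have := manifold_size; rewrite /complex_size big1 // => s sC.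
  apply/eqP; rewrite cards_eq0 -f0; apply/eqP; case/maxsetP: fC => _; apply => //.
  by rewrite f0 finset.sub0set.
case: manC => _ _ _ /(_ f fin f0)[_ + _].
rewrite linkf /complex_size big_set1 cards0 => /esym/eqP; rewrite subn_eq0 => le.
by apply/eqP; rewrite eqn_leq le face_card.
Qed.

Lemma link_sphere k : k \in C -> k != finset.set0 ->
  homeomorphic (realization (R := R) (link C k)) (unit_sphere (R := R) (m := d.+1 - #|k|)).
Proof. by case: manC => _ _ _ H kC k0; have [] := H k kC k0. Qed.

Lemma supp_barycenter u : u != finset.set0 -> supp (barycenter R u) = u.
Proof.
move=> u0; apply/finset.setP => v; rewrite inE mxE enum_rankK.
by case: ifP => _; rewrite ?eqxx // invr_eq0 pnatr_eq0 cards_eq0.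
Qed.

Lemma barycenter_realization (L : {set {set V}}) u : u != finset.set0 -> u \in L ->
  realization L (barycenter R u).
Proof.
move=> u0 uL; have [b0 b1 _] := barycenter_in_simplex R u0; split=> //.
by rewrite -/(supp _) supp_barycenter.
Qed.

(** The two points of the 0-sphere are the two vertices of the link. *)
Lemma ridge_link_two u : u \in C -> u != finset.set0 -> #|u| = d ->
  exists a b : V, a != b /\ forall z,
    ((z \notin u) && (z |: u \in C)) = (z == a) || (z == b).
Proof.
move=> uC u0 cu; have [f [g [_ fA gB fK gK]]] := link_sphere uC u0.
move: f g fA gB fK gK; rewrite cu subSnn => f g fA gB fK gK.
have [in_fA in_gB] : (forall x, realization (link C u) x -> unit_sphere (f x)) /\
  (forall q, unit_sphere q -> realization (link C u) (g q)) by split; [exact: fA|exact: gB].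
pose p (e : R) : 'rV[R]_1 := const_mx e.
have Sp e : e ^+ 2 = 1 -> unit_sphere (p e) by move=> e1;
  rewrite /unit_sphere /= big_ord1 mxE.
have S1 := Sp 1 (expr1n _ _); have S2 : unit_sphere (p (-1)) by apply: Sp;
  rewrite sqrrN expr1n.
have sphereP (q : 'rV[R]_1) : unit_sphere q -> q = p 1 \/ q = p (-1).
  rewrite /unit_sphere /= big_ord1 => /eqP; rewrite sqrf_eq1 => /orP[] /eqP e; [left|right];
  by apply/rowP => i; rewrite !mxE ord1 e.
have memP z : ((z \notin u) && (z |: u \in C)) = ([set z]%SET \in link C u).
  by rewrite mem_link // -finset.setI_eq0 finset.setI_eq0 disjoints1.
have vertexP x : realization (link C u) x ->
  exists2 z, [set z]%SET \in link C u & x = barycenter R [set z]%SET.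
  case=> x0 x1; rewrite -/(supp x) => xL.
  have cx : (#|supp x| <= 1)%N.
    move: xL; rewrite mem_link // => /andP[dis /face_card].
    by rewrite cardsU disjoint_setI0 // cards0 subn0 cu addnC -(addn1 d) leq_add2l.
  have [e|[z zx]] := set_0Vmem (supp x).
    move: x1; rewrite big1 => [/esym/eqP|i _]; first by rewrite oner_eq0.
    have : enum_val i \notin supp x by rewrite e inE.
    by rewrite inE enum_valK negbK => /eqP.
  have sx : supp x = [set z]%SET.
    by apply/esym/eqP; rewrite finset.eqEcard finset.sub1set zx cards1.
  exists z; first by rewrite -sx.
  have xi i : i != enum_rank z -> x 0 i = 0.
    move=> iz; have : enum_val i \notin supp x.
      by rewrite sx inE; apply: contra iz => /eqP<-; rewrite enum_valK.
    by rewrite inE enum_valK negbK => /eqP.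
  apply/rowP => i; rewrite mxE inE; have [ez|iz] := eqVneq (enum_val i) z.
    move: x1; rewrite (bigD1 i) //= big1 ?addr0 => [->|j ji]; first by rewrite cards1 invr1.
    by apply: xi; rewrite -ez enum_valK.
  by apply: xi; apply: contra iz => /eqP->; rewrite enum_rankK.
have [a xL gx] := vertexP _ (in_gB _ S1).
have [b yL gy] := vertexP _ (in_gB _ S2).
have fgK (z : 'rV[R]_1) : unit_sphere z -> f (g z) = z by move=> Sz; apply: gK; rewrite inE.
have gfK (z : 'rV[R]_#|V|) : realization (link C u) z -> g (f z) = z by move=> Sz;
  apply: fK; rewrite inE.
exists a, b; split.
  apply/eqP => xy; have := fgK _ S1; rewrite gx xy -gy fgK // => /rowP/(_ 0).
  rewrite !mxE; lra.
move=> z; rewrite memP; apply/idP/orP => [zL|[] /eqP-> //].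
have set1_neq0 (z' : V) : [set z']%SET != finset.set0 by apply/set0Pn; exists z';
  rewrite inE.
have zr := barycenter_realization (set1_neq0 z) zL.
have bar_inj (a' b' : V) : barycenter R [set a']%SET = barycenter R [set b']%SET ->
  a' == b'.
  by move=> /(congr1 (@supp R V)); rewrite !supp_barycenter // => /(congr1 (fun S :
    {set V} => a' \in S)); rewrite !inE eqxx => <-.
have [e|e] := sphereP _ (in_fA _ zr); [left|right]; apply: bar_inj.
  by rewrite -(gfK _ zr) e.
by rewrite -(gfK _ zr) e.
Qed.

(** Two facets containing [k] are compared along a path in the sphere [lk k]
    joining the barycenters of their faces opposite to [k]. *)
Lemma face_connected k : k \in C -> k != finset.set0 -> connected_star C k.
Proof.
have [m] := ubnP (d.+1 - #|k|); elim: m k => // m IH k lem kC k0.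
have [dk|kd] := leqP d #|k|; first exact: (ridge_connected facet_card).
move=> s t sC tC ks kt.
have [f [g [[cf cg] fA gB fK gK]]] := link_sphere kC k0.
have m1 : (1 < d.+1 - #|k|)%N by rewrite ltn_subRL addnC addSn ltnS.
have bary h : facet C h -> k \subset h -> realization (R := R) (link C k)
  (barycenter R (h :\: k)) /\
    supp (barycenter R (h :\: k)) \subset h.
  move=> hC kh; have h0 : h :\: k != finset.set0.
    by rewrite -card_gt0 (facet_setD facet_card) // subn_gt0 ltnS ltnW.
  split; first by apply: barycenter_realization => //; exact: facet_link.
  by rewrite supp_barycenter // finset.subsetDl.
have [bs ss] := bary s sC ks; have [bt st] := bary t tC kt.
have [c [cc Sc c0 c1]] := sphere_path m1 (fA _ bs) (fA _ bt).
apply: (@connected_star_of_path R V C complexC k _ (fun r => g (c r))) => //.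
- move=> u uC ku; have := proper_card ku => lt; apply: IH => //.
    exact: codim_lt lem lt (face_card uC).
  by apply: contraTneq ku => ->; rewrite properE finset.sub0set andbF.
- exact: (within_comp cg cc Sc).
- by move=> r; apply: gB; exact: Sc.
- by rewrite c0 fK ?inE.
- by rewrite c1 fK ?inE.
Qed.

Section Reduced.
Variable s0 : {set V}.
Let N := <<odd_generators C s0>>%G.

Lemma proper_connected k u : u \in C -> k \proper u -> connected_star C u.
Proof.
move=> uC ku; apply: face_connected => //; apply: contraTneq ku => ->.
by rewrite properE finset.sub0set andbF.
Qed.

Lemma facet_path_proper k t l : (#|k| < d)%N -> facet_path (star C k) t l ->
  proper_path (t :\: k) [seq f :\: k | f <- l].
Proof.
move=> kd /facet_path_starP[fl adj] i; rewrite size_map => il.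
have nthE j : (j <= size l)%N -> nth (t :\: k) [seq f :\: k | f <- t :: l] j = nth t (t
  :: l) j :\: k.
  by move=> jl; rewrite (nth_map t).
rewrite -[_ :: map _ _]/[seq f :\: k | f <- t :: l] nthE //.
have [iC ik] := fl _ (mem_nth t (il : (i < size (t :: l))%N)).
split; first by rewrite -card_gt0 (facet_setD facet_card) // subn_gt0 ltnS ltnW.
move=> lt; rewrite nthE // -finset.setDIl -card_gt0 cardsD subn_gt0.
have /(pathP t)/(_ i lt)/andP[/eqP e _] := adj.
rewrite (facet_card iC) in e; case: e => e.
by rewrite (leq_ltn_trans (subset_leq_card (finset.subsetIr _ _))) // e.
Qed.

Lemma link_path_near k t l (x : R) i : (#|k| < d)%N -> facet_path (star C k) t l ->
  0 <= x <= 1 -> (i <= size l)%N -> `|(size l)%:R * x - i%:R| <= 2^-1 ->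
  supp (realization_path (t :\: k) [seq f :\: k | f <- l] x) \subset nth t (t :: l) i.
Proof.
move=> kd pl x01 il near.
have := @realization_path_near R V (t :\: k) [seq f :\: k | f <- l] x i
  (facet_path_proper kd pl) x01.
rewrite size_map => /(_ il near)/in_simplex_supp sub.
apply: fintype.subset_trans sub _.
by rewrite -[_ :: map _ _]/[seq f :\: k | f <- t :: l] (nth_map t) // finset.subsetDl.
Qed.

Lemma face_trivial k : k \in C -> k != finset.set0 -> trivial_star C s0 N k.
Proof.
have [m] := ubnP (d.+1 - #|k|); elim: m k => // m IH k lem kC k0.
have [dk|kd] := leqP d #|k|; first exact: (ridge_trivial facet_card).
have [kd'|dk'] := leqP d #|k|.+1.
  have ck : #|k|.+1 = d by apply/eqP; rewrite eqn_leq kd.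
  apply: (codim2_trivial complexC facet_card) => //; last exact: manifold_size.
    exact: face_connected.
  move=> a ak akC; apply: ridge_link_two => //; last by rewrite cardsU1 ak.
  by apply/set0Pn; exists a; rewrite !inE eqxx.
move=> t p [l [pl ll <-]].
have [f [g [[cf cg] fA gB fK gK]]] := link_sphere kC k0.
have m2 : (2 < d.+1 - #|k|)%N by rewrite ltn_subRL addnC !addSn !ltnS.
pose P : R -> 'rV[R]_#|V| := realization_path (t :\: k) [seq f :\: k | f <- l].
have pr := facet_path_proper kd pl.
have [fl adj] := (facet_path_starP C k t l).1 pl.
have PL (x : R) : realization (link C k) (P (clamp01 x)).
  apply: realization_path_in => //; last exact: clamp01_itv.
    by have [sC sub] : simplicial_complex (link C k) by case: manC => _ _ _ /(_ k kC k0)[].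
  by move=> h; rewrite -[_ :: map _ _]/[seq f :\: k | f <- t :: l] =>
    /mapP[f' /fl[f'C kf'] ->]; exact: facet_link.
have cP : continuous (fun r => P (clamp01 r)).
  apply: (@continuous_after _ _ _ (@clamp01 R) P); first exact: continuous_realization_path.
  by apply: continuous_clamp => r; exact: cvg_id.
have z01 : 0 <= (0 : R) <= 1 by rewrite lexx ler01.
have o01 : 0 <= (1 : R) <= 1 by rewrite lexx ler01.
have P01 : P 0 = P 1.
  by rewrite /P realization_path1 (last_map (fun h : {set V} =>
    h :\: k) l t) ll /realization_path polygonal_path0.
have [H [cH SH H0 Hs H1]] := @sphere_contract R _ (fun r => f (P (clamp01 r))) m2
  (within_comp cf cP PL) (fun r => fA _ (PL r))
    (congr1 f (etrans (congr1 P (clamp01_id z01))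
    (etrans P01 (esym (congr1 P (clamp01_id o01)))))).
apply: (@contraction_good R V C complexC k (@proper_connected k) s0 N _ t l P (fun z =>
  g (H z))) => //.
- move=> v vk vC; apply: IH => //.
    by apply: codim_lt lem _ (face_card vC); rewrite cardsU1 vk.
  by apply/set0Pn; exists v; rewrite !inE eqxx.
- split.
  + exact: (within_comp cg cH SH).
  + by move=> z; apply: gB; exact: SH.
  + by move=> r r01; rewrite H0 // fK ?inE ?clamp01_id //; have := PL r; rewrite clamp01_id.
  + by move=> u; rewrite Hs.
  + by move=> x; rewrite H1.
- by move=> x i; exact: link_path_near.
Qed.

Lemma link0 : link C finset.set0 = C.
Proof.
apply/finset.setP => t; rewrite mem_link // finset.setU0 -finset.setI_eq0 finset.setI0 eqxx.
by [].
Qed.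

Lemma map_setD0 l : [seq f :\: finset.set0 | f <- l] = l.
Proof. by rewrite -[RHS]map_id; apply: eq_map => f; rewrite finset.setD0. Qed.

Lemma set0_card : (#|(finset.set0 : {set V})| < d)%N.
Proof. by rewrite cards0; exact: manifold_dim. Qed.

(** The subdivision argument for the link of the empty face, which is the whole
    complex. *)
Lemma null_homotopic_projectivity l : facet C s0 -> facet_loop C s0 l ->
  null_homotopic (realization C) (realization_path (R := R) s0 l) ->
    projectivity s0 l \in N.
Proof.
move=> s0C /andP[pl /eqP ll] /null_homotopic_free[H contr].
rewrite -facet_path_star0 in pl.
have conn0 : forall u, u \in C -> finset.set0 \proper u ->
  connected_star C u by exact: proper_connected.
have good_l : good C s0 N s0 (path_projectivity s0 l).
  apply: (@contraction_good R V C complexC finset.set0 conn0 s0 N _ s0 l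
    (realization_path s0 l) H) => //.
  - by move=> v _ vC; apply: face_trivial => //; apply/set0Pn; exists v; rewrite !inE eqxx.
  - by rewrite link0.
  - move=> r i r01 il near; have := link_path_near set0_card pl r01 il near.
    by rewrite finset.setD0 map_setD0.
have w1 := walk1 s0C (finset.sub0set s0).
by have := good_l 1%g w1; rewrite mul1g invg1 mulg1.
Qed.

Lemma odd_generator_null_homotopic p : p \in odd_generators C s0 -> exists l,
  [/\ facet_loop C s0 l, null_homotopic (realization C) (realization_path (R := R) s0 l)
    & p = projectivity s0 l].
Proof.
rewrite inE => /asboolP[g [k [l [gp [[[kC k0 _] _] _] /andP[lp /eqP ll] _ ->]]]].
exists (g ++ l ++ inverse_path s0 g).
rewrite -facet_path_star0 in gp.
have [gC adjg] := (facet_path_starP C _ s0 g).1 gp.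
have [lC adjl] := (facet_path_starP C _ _ l).1 lp.
have pw : facet_path (star C finset.set0) s0 (g ++ l ++ inverse_path s0 g).
  apply/facet_path_starP; split; last first.
    by rewrite !cat_path adjg adjl ll path_inverse_path.
  move=> u; rewrite finset.sub0set inE !mem_cat orbA -in_cons => /or3P[/gC[]|ul|] //.
    by have [] := lC u; rewrite ?inE ?ul ?orbT.
  by rewrite /inverse_path mem_rev => ug; have [] := gC u;
    rewrite // lastI mem_rcons inE ug orbT.
split=> //.
- rewrite /facet_loop -facet_path_star0 pw !last_cat ll; apply/eqP;
    exact: last_inverse_path.
- apply: (@lasso_null_homotopic R V C k s0 g l complexC k0) => //.
  + by have := facet_path_proper set0_card pw; rewrite finset.setD0 map_setD0.
  + by move=> f /((facet_path_starP C _ _ _).1 pw).1[fC _]; exact: facet_in.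
  + by move=> f /lC[].
Qed.

Lemma Pi0_generated : facet C s0 -> Pi0 R C s0 = <<odd_generators C s0>>%g.
Proof.
move=> s0C; apply/eqP; rewrite finset.eqEsubset !gen_subG; apply/andP; split.
  apply/fintype.subsetP => p; rewrite inE => /asboolP[l [ll nl ->]].
  exact: null_homotopic_projectivity.
apply/fintype.subsetP => p /odd_generator_null_homotopic[l H].
by apply: mem_gen; rewrite inE; apply/asboolP; exists l.
Qed.

Lemma odd_generators_transpositions :
  exists2 T : {set {perm V}}, (forall p, p \in T -> transposition s0 p) &
    <<odd_generators C s0>>%g = <<T>>%g.
Proof.
exists [set p in odd_generators C s0 | `[< transposition s0 p >]]%SET.
  by move=> p; rewrite inE => /andP[_ /asboolP].
apply/eqP; rewrite finset.eqEsubset !gen_subG; apply/andP; split;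
  apply/fintype.subsetP => p pT.
  have [->|tp] := odd_generator_transposition facet_card manifold_size pT;
    first exact: group1.
  by apply: mem_gen; rewrite inE pT; apply/asboolP.
by apply: mem_gen; move: pT; rewrite inE => /andP[].
Qed.

End Reduced.
End Manifolds.

Theorem theorem3p2 (R : realType) (V : finType) (d : nat)
    (Delta : {set {set V}}) (sigma0 : {set V})
    (hDelta : combinatorial_manifold R d Delta)
    (hsigma0 : facet Delta sigma0) :
  Pi0 R Delta sigma0 = <<odd_generators Delta sigma0>>%g /\
  exists2 T : {set {perm V}},
    (forall p, p \in T -> transposition sigma0 p) &
    Pi0 R Delta sigma0 = <<T>>%g.
Proof.
rewrite (Pi0_generated hDelta hsigma0); split=> //.
exact: odd_generators_transpositions hDelta sigma0.
Qed.
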